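(* Let $m\ge1$, $n\in\mathbb N$ and let $\mathcal P_2^{(m)}\subseteq\mathcal P^{(m)}$ be the category of all spatial pair partitions on $m$ levels. Then $G_{(n,\dots,n)}(\mathcal P_2^{(m)})$ (with $(n,\dots,n)\in\mathbb N^m$) is equivalent to $O_n^{z}$ with $z:=\circ^m$.
   Context: Colours: $\{\circ,\bullet\}^*$ is the free monoid of finite words in two colours with empty word $1$; $|x|$ is the length and $x_i$ the $i$-th letter of $x$; $\circ^m$ is the word of $m$ letters $\circ$. Spatial partitions: for $m\ge1$, $\mathcal P^{(m)}(x,y)$ is the set of set partitions (into blocks) of $\{1,\dots,|x|+|y|\}\times\{1,\dots,m\}$; points $(i,j)$ with $i\le|x|$ are upper points of colour $x_i$, points $(|x|+i,j)$ are lower points of colour $y_i$, and $j$ is the level. $\mathcal P^{(m)}=\bigcup_{x,y}\mathcal P^{(m)}(x,y)$. A pair partition is one all of whose blocks have size two (with arbitrary colours); $\mathcal P_2^{(m)}$ is the set of all pair partitions in $\mathcal P^{(m)}$, which is a rigid category of spatial partitions (closed under the usual composition, tensor product and involution, containing identity partitions and solutions of the conjugate equations), and $\mathcal P_2^{(m)}(x,y)=\mathcal P_2^{(m)}\cap\mathcal P^{(m)}(x,y)$. Quantum groups: for a finite-dimensional Hilbert space $V$ with conjugate $\overline V$, put $V^\circ=V$, $V^\bullet=\overline V$, $V^{\otimes x}=V^{x_1}\otimes\cdots\otimes V^{x_{|x|}}$ ($\mathbb C$ if $x=1$); for an operator $T$, $\overline T(\overline v)=\overline{T(v)}$, $T^\circ=T$,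 $T^\bullet=\overline T$, $T^{\otimes x}=T^{x_1}\otimes\cdots\otimes T^{x_{|x|}}$. Elements $u\in B(V)\otimes A$ ($A$ a unital $C^*$-algebra) are $A$-valued matrices $(u^i_j)$ in an orthonormal basis; $\overline u\in B(\overline V)\otimes A$ has entries $(u^i_j)^*$; $u\top v$ on $V\otimes W$ has entries $u^{i_1}_{j_1}v^{i_2}_{j_2}$. A compact matrix quantum group is $G=(C(G),u)$ with $C(G)$ a unital $C^*$-algebra generated by the entries of $u\in B(V)\otimes C(G)$, $u$ unitary, $\overline u$ invertible, and a $*$-homomorphism $\Delta:C(G)\to C(G)\otimes C(G)$ with $\Delta(u^i_j)=\sum_k u^i_k\otimes u^k_j$; $\mathcal O(G)$ is the $*$-algebra generated by the entries. A representation is an invertible $v\in B(W)\otimes C(G)$ with $\Delta(v^i_j)=\sum_k v^i_k\otimes v^k_j$; $\mathrm{Hom}(v,w)=\{T: Tv=wT\}$. Given $u^\circ=u$ and a unitary representation $u^\bullet$ on $\overline V$, $u^x=u^{x_1}\top\cdots\top u^{x_{|x|}}$, $u^1=1$. $u^\bullet$ is conjugate to $u^\circ$ if there are $R\in\mathrm{Hom}(1,u^\circ\top u^\bullet)$, $S\in\mathrm{Hom}(1,u^\bullet\top u^\circ)$ with $(R^*\otimes\mathrm{id}_V)(\mathrm{id}_V\otimes S)=\mathrm{id}_V$, $(S^*\otimes\mathrm{id}_{\overline V})(\mathrm{id}_{\overline V}\otimes R)=\mathrm{id}_{\overline V}$. Linear maps: for $\boldsymbol n=(n,\dots,n)\in\mathbb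 N^m$, $[\boldsymbol n]=\{1,\dots,n\}^m$ and $\mathbb C^{\boldsymbol n}=(\mathbb C^n)^{\otimes m}$ with basis $e_{\boldsymbol i}$, $\boldsymbol i\in[\boldsymbol n]$. For $p\in\mathcal P^{(m)}(x,y)$, $T_p^{(\boldsymbol n)}:(\mathbb C^{\boldsymbol n})^{\otimes x}\to(\mathbb C^{\boldsymbol n})^{\otimes y}$ has, in the canonical bases, matrix coefficient (input $\boldsymbol j_1,\dots,\boldsymbol j_{|x|}$, output $\boldsymbol i_1,\dots,\boldsymbol i_{|y|}$) equal to $1$ if, labelling upper point $(k,\ell)$ by the $\ell$-th entry of $\boldsymbol j_k$ and lower point $(|x|+k,\ell)$ by the $\ell$-th entry of $\boldsymbol i_k$, labels are constant on every block, and $0$ otherwise. For a rigid category $\mathcal C\subseteq\mathcal P^{(m)}$, $G_{\boldsymbol n}(\mathcal C)$ is the compact matrix quantum group with fundamental representation $u^\circ$ on $\mathbb C^{\boldsymbol n}$ and a unitary representation $u^\bullet$ on $\overline{\mathbb C^{\boldsymbol n}}$ such that $\mathrm{Hom}(u^x,u^y)=\mathrm{span}\{T_p^{(\boldsymbol n)}:p\in\mathcal C(x,y)\}$ for all $x,y$ (it exists by Woronowicz Tannaka–Krein duality, $\mathcal O(G)$ is unique, and $C(G)$ is taken to be the universal $C^*$-completion). $O_n$ is the classical orthogonal group, viewed as the compact matrix quantum group $(C(O_n),u)$ with $u^i_j$ the coordinate functions. For $z=\circ^m$, $O_n^z=(A,u^{z})$ with $u^z=u\top\cdots\top u$ ($m$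 factors) and $A\subseteq C(O_n)$ the $C^*$-subalgebra generated by the entries of $u^z$. Equivalence: compact matrix quantum groups $G$, $H$ with fundamental representations $u^\circ$ on $V$, $w^\circ$ on $W$ are equivalent if, for some unitary conjugate representations $u^\bullet$ on $\overline V$ and $w^\bullet$ on $\overline W$, there is a unitary $Q:V\to W$ with $\mathrm{Hom}(u^x,u^y)=(Q^{-1})^{\otimes y}\,\mathrm{Hom}(w^x,w^y)\,Q^{\otimes x}$ for all $x,y\in\{\circ,\bullet\}^*$. *)

(* Defs.v *)
From HB Require Import structures.
From mathcomp Require Import all_boot all_order all_algebra complex.
From mathcomp Require Import boolp classical_sets functions reals topology.
From mathcomp Require Import normedtype sequences ring.

Set Implicit Arguments.
Unset Strict Implicit.
Unset Printing Implicit Defensive.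

Import Order.TTheory GRing.Theory Num.Theory.
Import numFieldNormedType.Exports.
Import Normc.

Local Open Scope classical_set_scope.
Local Open Scope ring_scope.

Definition norm_limit (R : realType) (V : zmodType) (nrm : V -> R)
    (u : nat -> V) (l : V) : Prop :=
  forall e : R, 0 < e -> \forall k \near \oo, nrm (u k - l) < e.

Definition norm_cauchy (R : realType) (V : zmodType) (nrm : V -> R)
    (u : nat -> V) : Prop :=
  forall e : R, 0 < e ->
    exists N, forall p q, (N <= p)%N -> (N <= q)%N -> nrm (u p - u q) < e.

(* The norm is real-valued, and completeness and closedness are expressed with
   sequences: Hierarchy Builder does not accept the join of GRing.Algebra with
   the normed modules of the library. Note that 1 != 0 in GRing.Algebra. *)
HB.mixin Record isCStarAlgebra (R : realType) A & GRing.Algebra R[i] A := {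
  star : A -> A;
  starK : involutive star;
  starD : {morph star : x y / x + y};
  starM : forall x y, star (x * y) = star y * star x;
  starZ : forall (a : R[i]) x, star (a *: x) = a^* *: star x;
  cnorm : A -> R;
  cnormD : forall x y, cnorm (x + y) <= cnorm x + cnorm y;
  cnormZ : forall (a : R[i]) x, cnorm (a *: x) = normc a * cnorm x;
  cnorm_eq0 : forall x, cnorm x = 0 -> x = 0;
  cnormM : forall x y, cnorm (x * y) <= cnorm x * cnorm y;
  cnorm_star : forall x, cnorm (star x * x) = cnorm x ^+ 2;
  cnorm_complete : forall u : nat -> A,
    norm_cauchy cnorm u -> exists l, norm_limit cnorm u l
}.

#[short(type="cstarType")]
HB.structure Definition CStarAlgebra (R : realType) :=
  {A of GRing.Algebra R[i] A & isCStarAlgebra R A}.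

Record star_subalg (R : realType) (A : cstarType R) (S : set A) : Prop := {
  ssub1 : S 1;
  ssubD : forall x y, S x -> S y -> S (x + y);
  ssubZ : forall (a : R[i]) x, S x -> S (a *: x);
  ssubM : forall x y, S x -> S y -> S (x * y);
  ssubJ : forall x, S x -> S (star x)
}.

Record cstar_subalg (R : realType) (A : cstarType R) (S : set A) : Prop := {
  csub_star :> star_subalg S;
  csub_closed : forall (u : nat -> A) l,
    (forall k, S (u k)) -> norm_limit cnorm u l -> S l
}.

Definition star_gen (R : realType) (A : cstarType R) (G : set A) : set A :=
  [set x | forall S : set A, star_subalg S -> G `<=` S -> S x].

Definition cstar_gen (R : realType) (A : cstarType R) (G : set A) : set A :=
  [set x | forall S : set A, cstar_subalg S -> G `<=` S -> S x].

Lemma star_gen_subalg (R : realType) (A : cstarType R) (G : set A) :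
  star_subalg (star_gen G).
Proof.
split=> [S hS _|x y hx hy S hS GS|a x hx S hS GS|x y hx hy S hS GS|x hx S hS GS].
- exact: (ssub1 hS).
- by apply: (ssubD hS); [exact: hx|exact: hy].
- by apply: (ssubZ hS); exact: hx.
- by apply: (ssubM hS); [exact: hx|exact: hy].
- by apply: (ssubJ hS); exact: hx.
Qed.

Lemma cstar_gen_subalg (R : realType) (A : cstarType R) (G : set A) :
  cstar_subalg (cstar_gen G).
Proof.
split; last first.
  move=> u l hu ul S hS GS; apply: (csub_closed hS) ul => k; exact: hu.
split=> [S hS _|x y hx hy S hS GS|a x hx S hS GS|x y hx hy S hS GS|x hx S hS GS].
- exact: (ssub1 hS).
- by apply: (ssubD hS); [exact: hx|exact: hy].
- by apply: (ssubZ hS); exact: hx.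
- by apply: (ssubM hS); [exact: hx|exact: hy].
- by apply: (ssubJ hS); exact: hx.
Qed.

Lemma cstar_gen_sub (R : realType) (A : cstarType R) (G : set A) :
  G `<=` cstar_gen G.
Proof. by move=> x Gx S _; apply. Qed.

(* [subC S], for a C*-subalgebra [S] of [A], as a C*-algebra in its own
   right. *)
Record cstar_sub (R : realType) (A : cstarType R) := CStarSub {
  csub_set :> A -> Prop;
  csubP : cstar_subalg csub_set
}.

Definition subC (R : realType) (A : cstarType R) (S : cstar_sub A) : Type :=
  {x : A | `[< S x >]}.

Section SubC.
Context (R : realType) (A : cstarType R) (S : cstar_sub A).
Local Notation T := (subC S).

HB.instance Definition _ := SubChoice.on T.

Definition subC_val (x : T) : A := val x.

Definition mkC (x : A) (hx : S x) : T := Sub x (asboolT hx).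

Lemma mkCK x (hx : S x) : subC_val (mkC hx) = x.
Proof. by rewrite /subC_val SubK. Qed.

Lemma subC_valP (x : T) : S (subC_val x).
Proof. exact/asboolP/(valP x). Qed.

Lemma subC_inj : injective subC_val.
Proof. exact: val_inj. Qed.

Let hS := csubP S.

Lemma subC0 : S 0.
Proof. by rewrite -(scale0r 1); apply: (ssubZ hS); apply: (ssub1 hS). Qed.

Lemma subCN x : S x -> S (- x).
Proof. by move=> Sx; rewrite -scaleN1r; apply: (ssubZ hS). Qed.

Definition sC0 : T := mkC subC0.
Definition sCN (x : T) : T := mkC (subCN (subC_valP x)).
Definition sCD (x y : T) : T := mkC (ssubD hS (subC_valP x) (subC_valP y)).
Definition sC1 : T := mkC (ssub1 hS).
Definition sCM (x y : T) : T := mkC (ssubM hS (subC_valP x) (subC_valP y)).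
Definition sCZ (a : R[i]) (x : T) : T := mkC (ssubZ hS a (subC_valP x)).
Definition sCJ (x : T) : T := mkC (ssubJ hS (subC_valP x)).

Fact sCDA : associative sCD.
Proof. by move=> x y z; apply: subC_inj; rewrite !mkCK addrA. Qed.
Fact sCDC : commutative sCD.
Proof. by move=> x y; apply: subC_inj; rewrite !mkCK addrC. Qed.
Fact sCD0 : left_id sC0 sCD.
Proof. by move=> x; apply: subC_inj; rewrite !mkCK add0r. Qed.
Fact sCDN : left_inverse sC0 sCN sCD.
Proof. by move=> x; apply: subC_inj; rewrite !mkCK addNr. Qed.

HB.instance Definition _ := GRing.isZmodule.Build T sCDA sCDC sCD0 sCDN.

Fact sCMA : associative sCM.
Proof. by move=> x y z; apply: subC_inj; rewrite !mkCK mulrA. Qed.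
Fact sC1M : left_id sC1 sCM.
Proof. by move=> x; apply: subC_inj; rewrite !mkCK mul1r. Qed.
Fact sCM1 : right_id sC1 sCM.
Proof. by move=> x; apply: subC_inj; rewrite !mkCK mulr1. Qed.
Fact sCMDl : left_distributive sCM +%R.
Proof. by move=> x y z; apply: subC_inj; rewrite !mkCK mulrDl. Qed.
Fact sCMDr : right_distributive sCM +%R.
Proof. by move=> x y z; apply: subC_inj; rewrite !mkCK mulrDr. Qed.
Fact sC1_neq0 : sC1 != 0.
Proof.
by apply/eqP => /(congr1 subC_val); rewrite !mkCK; apply/eqP/oner_neq0.
Qed.

HB.instance Definition _ := GRing.Zmodule_isNzRing.Build T
  sCMA sC1M sCM1 sCMDl sCMDr sC1_neq0.

Fact sCZA a b (x : T) : sCZ a (sCZ b x) = sCZ (a * b) x.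
Proof. by apply: subC_inj; rewrite !mkCK scalerA. Qed.
Fact sC1Z : left_id 1 sCZ.
Proof. by move=> x; apply: subC_inj; rewrite !mkCK scale1r. Qed.
Fact sCZDr : right_distributive sCZ +%R.
Proof. by move=> a x y; apply: subC_inj; rewrite !mkCK scalerDr. Qed.
Fact sCZDl (x : T) : {morph sCZ^~ x : a b / a + b}.
Proof. by move=> a b; apply: subC_inj; rewrite !mkCK scalerDl. Qed.

HB.instance Definition _ := GRing.Zmodule_isLmodule.Build R[i] T
  sCZA sC1Z sCZDr sCZDl.

Fact sCZAl (a : R[i]) (x y : T) : a *: (x * y) = (a *: x) * y.
Proof. by apply: subC_inj; rewrite !mkCK scalerAl. Qed.
HB.instance Definition _ := GRing.Lmodule_isLalgebra.Build R[i] T sCZAl.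
Fact sCZAr (a : R[i]) (x y : T) : a *: (x * y) = x * (a *: y).
Proof. by apply: subC_inj; rewrite !mkCK scalerAr. Qed.
HB.instance Definition _ := GRing.Lalgebra_isAlgebra.Build R[i] T sCZAr.

Lemma subC_valB (x y : T) : subC_val (x - y) = subC_val x - subC_val y.
Proof. by rewrite !mkCK. Qed.

Definition sCnorm (x : T) : R := cnorm (subC_val x).

Fact sCJK : involutive sCJ.
Proof. by move=> x; apply: subC_inj; rewrite !mkCK starK. Qed.
Fact sCJD : {morph sCJ : x y / x + y}.
Proof. by move=> x y; apply: subC_inj; rewrite !mkCK starD. Qed.
Fact sCJM (x y : T) : sCJ (x * y) = sCJ y * sCJ x.
Proof. by apply: subC_inj; rewrite !mkCK starM. Qed.
Fact sCJZ (a : R[i]) (x : T) : sCJ (a *: x) = a^* *: sCJ x.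
Proof. by apply: subC_inj; rewrite !mkCK starZ. Qed.
Fact sCnormD (x y : T) : sCnorm (x + y) <= sCnorm x + sCnorm y.
Proof. by rewrite /sCnorm mkCK cnormD. Qed.
Fact sCnormZ (a : R[i]) (x : T) : sCnorm (a *: x) = normc a * sCnorm x.
Proof. by rewrite /sCnorm mkCK cnormZ. Qed.
Fact sCnorm0 (x : T) : sCnorm x = 0 -> x = 0.
Proof. by move=> /cnorm_eq0 x0; apply: subC_inj; rewrite mkCK. Qed.
Fact sCnormM (x y : T) : sCnorm (x * y) <= sCnorm x * sCnorm y.
Proof. by rewrite /sCnorm mkCK cnormM. Qed.
Fact sCnormJ (x : T) : sCnorm (sCJ x * x) = sCnorm x ^+ 2.
Proof. by rewrite /sCnorm !mkCK cnorm_star. Qed.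
Fact sC_complete (u : nat -> T) :
  norm_cauchy sCnorm u -> exists l, norm_limit sCnorm u l.
Proof.
move=> cu.
have [|l ul] := @cnorm_complete R A (subC_val \o u).
  move=> e e0; have [N hN] := cu e e0; exists N => p q Np Nq.
  by have := hN p q Np Nq; rewrite /sCnorm subC_valB.
have Sl : S l by apply: (csub_closed hS) ul => k; exact: subC_valP.
exists (mkC Sl) => e /ul; apply: filterS => k /=.
by rewrite /sCnorm subC_valB mkCK.
Qed.

HB.instance Definition _ := isCStarAlgebra.Build R T
  sCJK sCJD sCJM sCJZ sCnormD sCnormZ sCnorm0 sCnormM sCnormJ sC_complete.

End SubC.

Section Complex.
Context (R : realType).
Implicit Types z w : R[i].

Lemma normr_normc z : `|z| = (normc z)%:C%C.
Proof. by []. Qed.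

Lemma normc_ge0 z : 0 <= normc z.
Proof. by rewrite -ler0c -normr_normc. Qed.

Lemma normc_sub z w : normc (z - w) = normc (w - z).
Proof. by rewrite -normcN opprB. Qed.

Lemma normc_conj z : normc z^* = normc z.
Proof. by case: z => a b; rewrite /= sqrrN. Qed.

Lemma normc_conjM z : normc (z^* * z) = normc z ^+ 2.
Proof. by rewrite normcM normc_conj -expr2. Qed.

Lemma normc_le_dist z w : `|normc z - normc w| <= normc (z - w).
Proof.
rewrite ler_distl; apply/andP; split.
  by rewrite lerBlDr normc_sub -{1}(subrK z w) addrC le_normcD.
by rewrite addrC -{1}(subrK w z) le_normcD.
Qed.

Lemma normc_Re z : `|complex.Re z| <= normc z.
Proof. by rewrite -lecR -normr_normc normc_ge_Re. Qed.

Lemma normc_Im z : `|complex.Im z| <= normc z.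
Proof.
by case: z => a b /=; rewrite -sqrtr_sqr ler_sqrt ?lerDr ?sqr_ge0 // addr_ge0 ?sqr_ge0.
Qed.

Lemma normc_ReIm z : normc z <= `|complex.Re z| + `|complex.Im z|.
Proof.
rewrite {1}[z]complexE (le_trans (le_normcD _ _)) // normcM.
rewrite !/(normc _%:C%C) /= !expr0n /= !addr0 add0r expr1n sqrtr1 mul1r.
by rewrite !sqrtr_sqr.
Qed.

Lemma continuousCP (X : topologicalType) (f : X -> R[i]) :
  continuous (f : X -> R[i]^o) <->
  forall x (e : R), 0 < e -> \forall y \near x, normc (f x - f y) < e.
Proof.
split=> [cf x e e0|cf x].
  have /cvgrPdist_lt /(_ e%:C%C) := cf x.
  rewrite -[0]/(0%:C%C) ltcR => /(_ e0).
  by apply: filterS => y /=; rewrite normr_normc ltcR.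
apply/cvgrPdist_lt => e e0.
have re : (complex.Re e)%:C%C = e by apply: RRe_real; exact: gtr0_real.
have /(cf x) : 0 < complex.Re e by rewrite -ltcR re.
by apply: filterS => y; rewrite normr_normc -[in X in _ -> X]re ltcR.
Qed.

Lemma complex_complete (u : nat -> R[i]) :
  (forall e : R, 0 < e -> exists N, forall p q,
     (N <= p)%N -> (N <= q)%N -> normc (u p - u q) < e) ->
  exists l, forall e : R, 0 < e -> \forall k \near \oo, normc (u k - l) < e.
Proof.
move=> cu.
have aux (h : R[i] -> R) : (forall z w, h (z - w) = h z - h w) ->
    (forall z, `|h z| <= normc z) -> cvgn (h \o u).
  move=> hB hn; apply/cauchy_cvgP/cauchyP => e e0.
  have [N hN] := cu e e0.
  exists (h (u N)); exists N => // k /= Nk; rewrite -ball_normE /= -hB.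
  exact: le_lt_trans (hn _) (hN _ _ (leqnn N) Nk).
have cR : cvgn (@complex.Re R \o u) by apply: aux => [[? ?] [? ?]|z] //; exact: normc_Re.
have cI : cvgn (@complex.Im R \o u) by apply: aux => [[? ?] [? ?]|z] //; exact: normc_Im.
exists (limn (@complex.Re R \o u) +i* limn (@complex.Im R \o u))%C => e e0.
have e2 : 0 < e / 2 by rewrite divr_gt0.
move/cvgrPdist_lt : cR => /(_ _ e2) hR.
move/cvgrPdist_lt : cI => /(_ _ e2) hI.
near=> k; apply: le_lt_trans (normc_ReIm _) _.
rewrite (splitr e); apply: ltrD.
  have : `|limn (@complex.Re R \o u) - (@complex.Re R \o u) k| < e / 2 by near: k.
  by rewrite distrC /=; case: (u k).
have : `|limn (@complex.Im R \o u) - (@complex.Im R \o u) k| < e / 2 by near: k.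
by rewrite distrC /=; case: (u k).
Unshelve. all: by end_near. Qed.

End Complex.

Record compactSpace := CompactSpace {
  cs_sort :> topologicalType;
  cs_pt : cs_sort;
  cs_compact : compact [set: cs_sort]
}.

Record contC (R : realType) (X : compactSpace) := ContC {
  cfun :> X -> R[i];
  cfunP : continuous (cfun : X -> R[i]^o)
}.

Section ContC.
Context (R : realType) (X : compactSpace).
Local Notation T := (contC R X).

HB.instance Definition _ := gen_eqMixin T.
HB.instance Definition _ := gen_choiceMixin T.

Lemma contC_eq (f g : T) : f =1 g -> f = g.
Proof.
case: f g => [f cf] [g cg] /= /funext fg; subst g.
by congr ContC; exact: Prop_irrelevance.
Qed.

Lemma contC_near (f : T) x (e : R) : 0 < e ->
  \forall y \near x, normc (f x - f y) < e.
Proof. by have /continuousCP := @cfunP R X f; apply. Qed.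

Fact contC_cst (a : R[i]) : continuous ((fun _ => a) : X -> R[i]^o).
Proof. by move=> x; exact: cvg_cst. Qed.
Fact contC_opp (f : T) : continuous ((fun x => - f x) : X -> R[i]^o).
Proof. by move=> x; apply: cvgN; exact: cfunP. Qed.
Fact contC_add (f g : T) : continuous ((fun x => f x + g x) : X -> R[i]^o).
Proof. by move=> x; apply: cvgD; exact: cfunP. Qed.
Fact contC_mul (f g : T) : continuous ((fun x => f x * g x) : X -> R[i]^o).
Proof.
by move=> x; apply: (@cvgM _ _ (nbhs x) _ (f : X -> R[i]^o) (g : X -> R[i]^o));
  exact: cfunP.
Qed.
Fact contC_conj (f : T) : continuous ((fun x => (f x)^* ) : X -> R[i]^o).
Proof.
apply/continuousCP => x e e0; apply: filterS (contC_near f x e0) => y.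
by rewrite -rmorphB normc_conj.
Qed.

Definition fC0 : T := ContC (@contC_cst 0).
Definition fC1 : T := ContC (@contC_cst 1).
Definition fCN (f : T) : T := ContC (@contC_opp f).
Definition fCD (f g : T) : T := ContC (@contC_add f g).
Definition fCM (f g : T) : T := ContC (@contC_mul f g).
Definition fCZ (a : R[i]) (f : T) : T := fCM (ContC (@contC_cst a)) f.
Definition fCJ (f : T) : T := ContC (@contC_conj f).

Fact fCDA : associative fCD.
Proof. by move=> f g h; apply: contC_eq => x /=; rewrite addrA. Qed.
Fact fCDC : commutative fCD.
Proof. by move=> f g; apply: contC_eq => x /=; rewrite addrC. Qed.
Fact fCD0 : left_id fC0 fCD.
Proof. by move=> f; apply: contC_eq => x /=; rewrite add0r. Qed.
Fact fCDN : left_inverse fC0 fCN fCD.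
Proof. by move=> f; apply: contC_eq => x /=; rewrite addNr. Qed.

HB.instance Definition _ := GRing.isZmodule.Build T fCDA fCDC fCD0 fCDN.

Fact fCMA : associative fCM.
Proof. by move=> f g h; apply: contC_eq => x /=; rewrite mulrA. Qed.
Fact fC1M : left_id fC1 fCM.
Proof. by move=> f; apply: contC_eq => x /=; rewrite mul1r. Qed.
Fact fCM1 : right_id fC1 fCM.
Proof. by move=> f; apply: contC_eq => x /=; rewrite mulr1. Qed.
Fact fCMDl : left_distributive fCM +%R.
Proof. by move=> f g h; apply: contC_eq => x /=; rewrite mulrDl. Qed.
Fact fCMDr : right_distributive fCM +%R.
Proof. by move=> f g h; apply: contC_eq => x /=; rewrite mulrDr. Qed.
Fact fC1_neq0 : fC1 != 0.
Proof.
apply/eqP => /(congr1 (fun f : T => f (cs_pt X))) /= /eqP.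
by rewrite oner_eq0.
Qed.

HB.instance Definition _ := GRing.Zmodule_isNzRing.Build T
  fCMA fC1M fCM1 fCMDl fCMDr fC1_neq0.

Fact fCZA a b (f : T) : fCZ a (fCZ b f) = fCZ (a * b) f.
Proof. by apply: contC_eq => x /=; rewrite mulrA. Qed.
Fact fC1Z : left_id 1 fCZ.
Proof. by move=> f; apply: contC_eq => x /=; rewrite mul1r. Qed.
Fact fCZDr : right_distributive fCZ +%R.
Proof. by move=> a f g; apply: contC_eq => x /=; rewrite mulrDr. Qed.
Fact fCZDl (f : T) : {morph fCZ^~ f : a b / a + b}.
Proof. by move=> a b; apply: contC_eq => x /=; rewrite mulrDl. Qed.

HB.instance Definition _ := GRing.Zmodule_isLmodule.Build R[i] T
  fCZA fC1Z fCZDr fCZDl.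

Fact fCZAl (a : R[i]) (f g : T) : a *: (f * g) = (a *: f) * g.
Proof. by apply: contC_eq => x /=; rewrite mulrA. Qed.
HB.instance Definition _ := GRing.Lmodule_isLalgebra.Build R[i] T fCZAl.
Fact fCZAr (a : R[i]) (f g : T) : a *: (f * g) = f * (a *: g).
Proof. by apply: contC_eq => x /=; rewrite mulrCA. Qed.
HB.instance Definition _ := GRing.Lalgebra_isAlgebra.Build R[i] T fCZAr.

Definition fCnorm (f : T) : R := sup (range (fun x => normc (f x))).

Fact fCnorm_has_sup (f : T) : has_sup (range (fun x => normc (f x))).
Proof.
apply: compact_has_sup; first by exists (normc (f (cs_pt X))); exists (cs_pt X).
apply: continuous_compact; last exact: cs_compact.
apply: continuous_subspaceT => x; apply/cvgrPdist_lt => e e0.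
apply: filterS (contC_near f x e0) => y; exact: le_lt_trans (normc_le_dist _ _).
Qed.

Lemma fCnorm_ub (f : T) x : normc (f x) <= fCnorm f.
Proof.
by apply: sup_upper_bound; [exact: fCnorm_has_sup|exists x].
Qed.

Lemma fCnorm_le (f : T) (M : R) : (forall x, normc (f x) <= M) -> fCnorm f <= M.
Proof.
move=> fM; apply: ge_sup; first by have [] := fCnorm_has_sup f.
by move=> _ [x _ <-].
Qed.

Lemma fCnorm_ge0 (f : T) : 0 <= fCnorm f.
Proof. exact: le_trans (normc_ge0 _) (fCnorm_ub f (cs_pt X)). Qed.

Fact fCJK : involutive fCJ.
Proof. by move=> f; apply: contC_eq => x /=; rewrite conjCK. Qed.
Fact fCJD : {morph fCJ : f g / f + g}.
Proof. by move=> f g; apply: contC_eq => x /=; rewrite rmorphD. Qed.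
Fact fCJM (f g : T) : fCJ (f * g) = fCJ g * fCJ f.
Proof. by apply: contC_eq => x /=; rewrite rmorphM mulrC. Qed.
Fact fCJZ (a : R[i]) (f : T) : fCJ (a *: f) = a^* *: fCJ f.
Proof. by apply: contC_eq => x /=; rewrite rmorphM. Qed.
Fact fCnormD (f g : T) : fCnorm (f + g) <= fCnorm f + fCnorm g.
Proof.
apply: fCnorm_le => x; apply: le_trans (le_normcD _ _) _.
by apply: lerD; exact: fCnorm_ub.
Qed.
Fact fCnormZ (a : R[i]) (f : T) : fCnorm (a *: f) = normc a * fCnorm f.
Proof.
apply/eqP; rewrite eq_le; apply/andP; split.
  by apply: fCnorm_le => x; rewrite normcM ler_wpM2l ?normc_ge0 ?fCnorm_ub.
have [->|a0] := eqVneq a 0; first by rewrite normc0 mul0r fCnorm_ge0.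
have na0 : 0 < normc a.
  by rewrite lt_def normc_ge0 andbT; apply: contra a0 => /eqP/eq0_normc ->.
rewrite mulrC -ler_pdivlMr //; apply: fCnorm_le => x.
rewrite ler_pdivlMr // mulrC -normcM; exact: (fCnorm_ub (a *: f)).
Qed.
Fact fCnorm0 (f : T) : fCnorm f = 0 -> f = 0.
Proof.
move=> f0; apply: contC_eq => x; apply: eq0_normc; apply/eqP.
by rewrite eq_le normc_ge0 andbT -f0 fCnorm_ub.
Qed.
Fact fCnormM (f g : T) : fCnorm (f * g) <= fCnorm f * fCnorm g.
Proof.
apply: fCnorm_le => x; rewrite normcM.
by apply: ler_pM; rewrite ?normc_ge0 ?fCnorm_ub.
Qed.
Fact fCnormJ (f : T) : fCnorm (fCJ f * f) = fCnorm f ^+ 2.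
Proof.
apply/eqP; rewrite eq_le; apply/andP; split.
  apply: fCnorm_le => x; rewrite normc_conjM.
  by rewrite lerXn2r ?nnegrE ?normc_ge0 ?fCnorm_ge0 ?fCnorm_ub.
rewrite -[leRHS]sqr_sqrtr ?fCnorm_ge0 // lerXn2r ?nnegrE ?sqrtr_ge0 ?fCnorm_ge0 //.
apply: fCnorm_le => x; rewrite -[leLHS]ger0_norm ?normc_ge0 // -sqrtr_sqr.
by rewrite ler_sqrt ?fCnorm_ge0 // -normc_conjM; exact: (fCnorm_ub (fCJ f * f)).
Qed.

Fact fC_complete (u : nat -> T) :
  norm_cauchy fCnorm u -> exists l, norm_limit fCnorm u l.
Proof.
move=> cu.
have cux x : exists l, forall e : R, 0 < e ->
    \forall k \near \oo, normc (u k x - l) < e.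
  apply: complex_complete => e e0; have [N hN] := cu e e0.
  exists N => p q Np Nq.
  exact: le_lt_trans (fCnorm_ub (u p - u q) x) (hN p q Np Nq).
have [l hl] := choice cux.
have ul (e : R) : 0 < e ->
    exists N, forall k, (N <= k)%N -> forall x, normc (u k x - l x) <= e.
  move=> e0; have [N hN] := cu _ e0.
  exists N => k Nk x; apply/ler_addgt0Pr => d d0.
  have [M _ hM] := hl x _ d0.
  have {}hM := hM (maxn N M) (leq_maxr _ _).
  have -> : u k x - l x = (u k x - u (maxn N M) x) + (u (maxn N M) x - l x).
    by rewrite addrA subrK.
  apply: le_trans (le_normcD _ _) _; apply: lerD; last exact: ltW.
  apply: le_trans (fCnorm_ub (u k - u (maxn N M)) x) _.
  by apply/ltW/hN => //; exact: leq_maxl.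
have cl : continuous (l : X -> R[i]^o).
  apply/continuousCP => x e e0; have e3 : 0 < e / 3 by rewrite divr_gt0.
  have [N hN] := ul _ e3.
  apply: filterS (contC_near (u N) x e3) => y hy.
  have -> : l x - l y = (l x - u N x) + (u N x - u N y) + (u N y - l y).
    by rewrite !addrA !subrK.
  apply: le_lt_trans (le_normcD _ _) _.
  have -> : e = e / 3 + e / 3 + e / 3.
    have {1}<- : e / 3 *+ 3 = e by rewrite -mulr_natr divfK ?pnatr_eq0.
    by rewrite mulrSr mulr2n.
  apply: ltr_leD; last exact: hN.
  apply: le_lt_trans (le_normcD _ _) _.
  by apply: ler_ltD => //; rewrite normc_sub hN.
exists (ContC cl) => e e0; have e2 : 0 < e / 2 by rewrite divr_gt0.
have [N hN] := ul _ e2; exists N => // k /= Nk.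
apply: (@le_lt_trans _ _ (e / 2)); last by rewrite ltr_pdivrMr // ltr_pMr // ltr1n.
by apply: fCnorm_le => x; exact: hN.
Qed.

HB.instance Definition _ := isCStarAlgebra.Build R T
  fCJK fCJD fCJM fCJZ fCnormD fCnormZ fCnorm0 fCnormM fCnormJ fC_complete.

End ContC.

Record star_hom_on (R : realType) (A B : cstarType R) (S : set A)
    (f : A -> B) : Prop := {
  shom1 : f 1 = 1;
  shomD : forall x y, S x -> S y -> f (x + y) = f x + f y;
  shomZ : forall (a : R[i]) x, S x -> f (a *: x) = a *: f x;
  shomM : forall x y, S x -> S y -> f (x * y) = f x * f y;
  shomJ : forall x, S x -> f (star x) = star (f x)
}.

Definition star_hom (R : realType) (A B : cstarType R) (f : A -> B) : Prop :=
  star_hom_on setT f.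

(* Positive functionals of norm 1. *)
Record state (R : realType) (A : cstarType R) (phi : A -> R[i]) : Prop := {
  stateD : forall x y, phi (x + y) = phi x + phi y;
  stateZ : forall (a : R[i]) x, phi (a *: x) = a * phi x;
  state_ge0 : forall x, 0 <= phi (star x * x);
  state_le : forall x, normc (phi x) <= cnorm x;
  state1 : phi 1 = 1
}.

(* The list [:: (a1, b1); (a2, b2); ...] stands for a1 (x) b1 + a2 (x) b2 + ...
   in the algebraic tensor product of A and B. *)
Section FormalTensors.
Context (R : realType) (A B : cstarType R).
Implicit Types (s t : seq (A * B)).

Definition ften_mul s t : seq (A * B) :=
  [seq (p.1 * q.1, p.2 * q.2) | p <- s, q <- t].

Definition ften_star t : seq (A * B) := [seq (star p.1, star p.2) | p <- t].

Definition ften_eval (phi : A -> R[i]) (psi : B -> R[i]) t : R[i] :=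
  \sum_(p <- t) phi p.1 * psi p.2.

(* The spatial norm of t is the supremum of the norms of its images under the
   tensor products of the GNS representations of states phi of A and psi of B,
   which is the GNS representation of phi (x) psi:
     |t|^2 = sup (phi (x) psi)(r^* t^* t r) / (phi (x) psi)(r^* r). *)
Definition spatial_bound t (M : R) : Prop :=
  0 <= M /\
  forall phi psi, state phi -> state psi -> forall r : seq (A * B),
    ften_eval phi psi (ften_mul (ften_star (ften_mul t r)) (ften_mul t r))
      <= (M ^+ 2)%:C%C * ften_eval phi psi (ften_mul (ften_star r) r).

Definition spatial_norm t (M : R) : Prop :=
  spatial_bound t M /\ forall M', spatial_bound t M' -> M <= M'.

End FormalTensors.

(* The spatial (minimal) tensor product of two C*-algebras, unique up to
   isomorphism. *)
Record spatial_tensor (R : realType) (A B : cstarType R) := SpatialTensor {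
  st_alg :> cstarType R;
  st_inl : A -> st_alg;
  st_inr : B -> st_alg;
  st_inl_hom : star_hom st_inl;
  st_inr_hom : star_hom st_inr;
  st_comm : forall a b, st_inl a * st_inr b = st_inr b * st_inl a;
  st_gen : cstar_gen (range st_inl `|` range st_inr) = setT;
  st_norm : forall t : seq (A * B),
    spatial_norm t (cnorm (\sum_(p <- t) st_inl p.1 * st_inr p.2))
}.

(* An element of B(C^J, C^I) (x) A, for finite types I and J indexing
   orthonormal bases, is a function I -> J -> A. *)
Section Matrices.
Context (A : pzSemiRingType).

Definition mmul (I J K : finType) (v : I -> J -> A) (w : J -> K -> A)
  : I -> K -> A := fun i k => \sum_j v i j * w j k.

Definition midm (I : finType) : I -> I -> A := fun i j => (i == j)%:R.

Definition minverse (I J : finType) (v : I -> J -> A) (w : J -> I -> A) : Prop :=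
  mmul v w =2 @midm I /\ mmul w v =2 @midm J.

Definition mtop (I J : finType) (v : I -> I -> A) (w : J -> J -> A)
  : I * J -> I * J -> A := fun i j => v i.1 j.1 * w i.2 j.2.

End Matrices.

Inductive colour := White | Black.

Definition word := seq colour.

Definition by_colour (T : Type) (a b : T) (c : colour) : T :=
  if c is White then a else b.

(* The index set of the canonical basis of V^{(x) x} when I is the one of V. *)
Definition mindex (I : finType) (x : word) := {ffun 'I_(size x) -> I}.

Definition tpow (A : pzSemiRingType) (I J : finType)
    (f : colour -> I -> J -> A) (x : word) : mindex I x -> mindex J x -> A :=
  fun i j => \prod_(k < size x) f (nth White x k) (i k) (j k).

Arguments tpow {A I J} f x.

Section CMatrices.
Context (R : realType) (A : cstarType R).

Definition madj (I J : finType) (v : I -> J -> A) : J -> I -> A :=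
  fun j i => star (v i j).

Definition mbar (I J : finType) (v : I -> J -> A) : I -> J -> A :=
  fun i j => star (v i j).

Definition mscal (I J : finType) (T : I -> J -> R[i]) : I -> J -> A :=
  fun i j => (T i j)%:A.

Definition minvertible (I : finType) (v : I -> I -> A) : Prop :=
  exists w, minverse v w.

Definition munitary (I : finType) (v : I -> I -> A) : Prop :=
  minverse v (madj v).

Definition triv_rep : unit -> unit -> A := fun _ _ => 1.

Definition Hom_rep (I J : finType) (v : I -> I -> A) (w : J -> J -> A)
  : set (J -> I -> R[i]) :=
  [set T | mmul (mscal T) v =2 mmul w (mscal T)].

Definition entries (I J : finType) (v : I -> J -> A) : set A :=
  [set a | exists i j, a = v i j].

End CMatrices.

Definition cconj (R : realType) (I J : finType) (Q : I -> J -> R[i])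
  : I -> J -> R[i] := fun i j => (Q i j)^*.

Definition cadj (R : realType) (I J : finType) (Q : I -> J -> R[i])
  : J -> I -> R[i] := fun j i => (Q i j)^*.

(* A compact matrix quantum group (C(G), u) whose fundamental representation u
   acts on C^I; the chosen tensor product only fixes a model of
   C(G) (x) C(G). *)
Record cmqg (R : realType) (I : finType) := CMQG {
  qg_alg :> cstarType R;
  qg_fund : I -> I -> qg_alg;
  qg_fund_unitary : munitary qg_fund;
  qg_fund_bar : minvertible (mbar qg_fund);
  qg_gen : cstar_gen (entries qg_fund) = setT;
  qg_tensor : spatial_tensor qg_alg qg_alg;
  qg_comul : qg_alg -> qg_tensor;
  qg_comul_hom : star_hom qg_comul;
  qg_comul_fund : forall i j, qg_comul (qg_fund i j) =
    \sum_k st_inl qg_tensor (qg_fund i k) * st_inr qg_tensor (qg_fund k j)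
}.

Section QuantumGroups.
Context (R : realType) (I : finType) (G : cmqg R I).

Definition qg_O : set G := star_gen (entries (qg_fund G)).

Definition representation (J : finType) (v : J -> J -> G) : Prop :=
  minvertible v /\
  forall i j, qg_comul (v i j) =
    \sum_k st_inl (qg_tensor G) (v i k) * st_inr (qg_tensor G) (v k j).

Definition unitary_rep (J : finType) (v : J -> J -> G) : Prop :=
  representation v /\ munitary v.

(* u^x, where u^White is the fundamental representation and u^Black = ubar. *)
Definition rep_word (ubar : I -> I -> G) (x : word)
  : mindex I x -> mindex I x -> G :=
  tpow (by_colour (qg_fund G) ubar) x.

(* r and s are the coordinates of R and S; the last two clauses are the
   conjugate equations (R^* (x) id)(id (x) S) = id and
   (S^* (x) id)(id (x) R) = id evaluated on the canonical bases. *)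
Definition conjugate_rep (ubar : I -> I -> G) : Prop :=
  exists r s : I * I -> unit -> R[i],
  [/\ Hom_rep (triv_rep G) (mtop (qg_fund G) ubar) r,
      Hom_rep (triv_rep G) (mtop ubar (qg_fund G)) s,
      forall a c, \sum_b (r (a, b) tt)^* * s (b, c) tt = (a == c)%:R
    & forall a c, \sum_b (s (a, b) tt)^* * r (b, c) tt = (a == c)%:R].

Definition universal_completion : Prop :=
  forall (B : cstarType R) (f : G -> B), star_hom_on qg_O f ->
    exists g : G -> B, star_hom g /\ forall x, qg_O x -> g x = f x.

End QuantumGroups.

Arguments rep_word {R I G} ubar x.

(* cadj Q is the inverse of the unitary Q. *)
Definition equivalent (R : realType) (I J : finType)
    (G : cmqg R I) (H : cmqg R J) : Prop :=
  exists (ubar : I -> I -> G) (wbar : J -> J -> H),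
  [/\ unitary_rep ubar, conjugate_rep ubar,
      unitary_rep wbar, conjugate_rep wbar
    & exists Q : J -> I -> R[i],
      minverse Q (cadj Q) /\
      forall x y : word,
        Hom_rep (rep_word ubar x) (rep_word ubar y) =
        [set mmul
               (mmul (tpow (by_colour (cadj Q) (cconj (cadj Q))) y) S)
               (tpow (by_colour Q (cconj Q)) x)
         | S in Hom_rep (rep_word wbar x) (rep_word wbar y)]].

(* The point (k, l) of a partition in P^(m)(x, y) is an upper point if
   k < |x| and a lower point otherwise; levels and positions count from 0. *)
Definition spoint (m : nat) (x y : word) : finType :=
  ('I_(size x + size y) * 'I_m)%type.

Definition spatial_family (m : nat) : Type :=
  forall x y : word, {set {set {set spoint m x y}}}.

Definition spatial_partitions (m : nat) : spatial_family m :=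
  fun x y => [set p | finset.partition p [set: spoint m x y]]%SET.

Definition pair_partitions (m : nat) : spatial_family m :=
  fun x y => [set p | (p \in spatial_partitions m x y)
            && [forall B in p, #|B| == 2]]%SET.

Section PartitionMaps.
Context (R : realType) (m n : nat).
Local Notation idx := {ffun 'I_m -> 'I_n}.

Definition plabel (x y : word) (j : mindex idx x) (i : mindex idx y)
    (a : spoint m x y) : 'I_n :=
  match fintype.split a.1 with inl k => j k a.2 | inr k => i k a.2 end.

Definition Tmap (x y : word) (p : {set {set spoint m x y}})
  : mindex idx y -> mindex idx x -> R[i] :=
  fun i j =>
    [forall B in p, forall a in B, forall b in B,
       plabel j i a == plabel j i b]%:R.

Definition Tspan (C : spatial_family m) (x y : word)
  : set (mindex idx y -> mindex idx x -> R[i]) :=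
  [set T | exists c : {set {set spoint m x y}} -> R[i],
     T = fun i j => \sum_(p in C x y) c p * Tmap p i j].

Arguments Tspan C x y : clear implicits.

(* G = G_(n,...,n)(C), up to isomorphism. *)
Definition is_G (C : spatial_family m) (G : cmqg R idx) : Prop :=
  (exists ubar : idx -> idx -> G,
     unitary_rep ubar /\
     forall x y : word, Hom_rep (rep_word ubar x) (rep_word ubar y) = Tspan C x y) /\
  universal_completion G.

End PartitionMaps.

Section FunctionTensor.
Context (R : realType) (X Y : compactSpace).
Context (SA : cstar_sub (contC R X)) (SB : cstar_sub (contC R Y)).
Local Notation A := (subC SA).
Local Notation B := (subC SB).

Definition prod_space : compactSpace.
Proof.
apply: (@CompactSpace (X * Y)%type (cs_pt X, cs_pt Y)).
by rewrite -setXTT; apply: compact_setX; exact: cs_compact.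
Defined.

Definition evA (a : A) (x : X) : R[i] := subC_val a x.
Definition evB (b : B) (y : Y) : R[i] := subC_val b y.

Fact lift1_continuous (f : contC R X) :
  continuous ((fun z => f z.1) : prod_space -> R[i]^o).
Proof.
move=> z; apply: (@continuous_comp _ _ _ (fst : X * Y -> X) (f : X -> R[i]^o)).
  exact: cvg_fst.
exact: cfunP.
Qed.

Fact lift2_continuous (f : contC R Y) :
  continuous ((fun z => f z.2) : prod_space -> R[i]^o).
Proof.
move=> z; apply: (@continuous_comp _ _ _ (snd : X * Y -> Y) (f : Y -> R[i]^o)).
  exact: cvg_snd.
exact: cfunP.
Qed.

Definition lift1 (f : contC R X) : contC R prod_space := ContC (@lift1_continuous f).
Definition lift2 (f : contC R Y) : contC R prod_space := ContC (@lift2_continuous f).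

Definition ften_gens : set (contC R prod_space) :=
  range (lift1 \o @subC_val _ _ SA) `|` range (lift2 \o @subC_val _ _ SB).

Definition ften_sub : cstar_sub (contC R prod_space) :=
  CStarSub (cstar_gen_subalg ften_gens).

Local Notation T := (subC ften_sub).

Fact ften_in1 (a : A) : ften_sub (lift1 (subC_val a)).
Proof. by apply: cstar_gen_sub; left; exists a. Qed.
Fact ften_in2 (b : B) : ften_sub (lift2 (subC_val b)).
Proof. by apply: cstar_gen_sub; right; exists b. Qed.

Definition ften_inl (a : A) : T := mkC (ften_in1 a).
Definition ften_inr (b : B) : T := mkC (ften_in2 b).

Fact ften_inl_hom : star_hom ften_inl.
Proof.
by split=> *; apply: subC_inj; apply: contC_eq => z; rewrite !mkCK /= ?mkCK.
Qed.

Fact ften_inr_hom : star_hom ften_inr.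
Proof.
by split=> *; apply: subC_inj; apply: contC_eq => z; rewrite !mkCK /= ?mkCK.
Qed.

Fact ften_comm a b : ften_inl a * ften_inr b = ften_inr b * ften_inl a.
Proof.
by apply: subC_inj; apply: contC_eq => z; rewrite !mkCK /= mulrC.
Qed.

End FunctionTensor.

Lemma subC_cnorm (R : realType) (A : cstarType R) (S : cstar_sub A)
  (x : subC S) : cnorm x = cnorm (subC_val x).
Proof. by []. Qed.

Section SubGen.
Context (R : realType) (A : cstarType R) (G : set A).
Local Notation S := (CStarSub (cstar_gen_subalg G)).

Lemma subC_gen (H : set (subC S)) :
  (forall x, G x -> exists2 h, H h & subC_val h = x) -> cstar_gen H = setT.
Proof.
move=> GH; rewrite eqEsubset; split=> // x _ U hU HU.
pose V := [set y : A | exists2 u, U u & subC_val u = y].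
have hV : cstar_subalg V.
  split; first split.
  - by exists 1; [exact: (ssub1 hU)|rewrite mkCK].
  - move=> _ _ [u Uu <-] [v Uv <-].
    by exists (u + v); [exact: (ssubD hU)|rewrite mkCK].
  - by move=> a _ [u Uu <-]; exists (a *: u); [exact: (ssubZ hU)|rewrite mkCK].
  - move=> _ _ [u Uu <-] [v Uv <-].
    by exists (u * v); [exact: (ssubM hU)|rewrite mkCK].
  - by move=> _ [u Uu <-]; exists (star u); [exact: (ssubJ hU)|rewrite mkCK].
  move=> u l hu ul.
  have [v hv] := choice (fun k => let: ex_intro2 w p q := hu k in
    ex_intro (fun w => U w /\ subC_val w = u k) w (conj p q)).
  have Sl : S l.
    apply: (csub_closed (csubP S)) ul => k.
    by have [_ <-] := hv k; exact: subC_valP.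
  exists (mkC Sl); last exact: mkCK.
  apply: (csub_closed hU (u := v)); first by move=> k; have [] := hv k.
  move=> e /ul; apply: filterS => k.
  rewrite subC_cnorm subC_valB mkCK.
  by have [_ ->] := hv k.
have Vx : V (subC_val x).
  apply: (subC_valP x) => // y Gy.
  by have [h Hh hy] := GH _ Gy; exists h => //; exact: HU.
by case: Vx => u Uu /subC_inj <-.
Qed.

End SubGen.

Section FunctionTensorNorm.
Context (R : realType) (X Y : compactSpace).
Context (SA : cstar_sub (contC R X)) (SB : cstar_sub (contC R Y)).
Local Notation A := (subC SA).
Local Notation B := (subC SB).
Local Notation T := (subC (ften_sub SA SB)).

Fact ften_gen :
  cstar_gen (range (@ften_inl R X Y SA SB) `|` range (@ften_inr R X Y SA SB))
  = setT.
Proof.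
apply: subC_gen => _ [[a _ <-]|[b _ <-]].
  by exists (ften_inl SB a); [left; exists a|rewrite mkCK].
by exists (ften_inr SA b); [right; exists b|rewrite mkCK].
Qed.

Section States.
Context (Z : compactSpace) (S : cstar_sub (contC R Z)).
Implicit Types (phi : subC S -> R[i]) (a : subC S).

Lemma state0 phi : state phi -> phi 0 = 0.
Proof. by move=> h; rewrite -(scale0r 0) (stateZ h) mul0r. Qed.

Lemma state_sum phi (I : Type) (r : seq I) (F : I -> subC S) : state phi ->
  phi (\sum_(i <- r) F i) = \sum_(i <- r) phi (F i).
Proof.
move=> h; elim: r => [|i r IH]; first by rewrite !big_nil state0.
by rewrite !big_cons (stateD h) IH.
Qed.

Lemma evA_sum (I : Type) (r : seq I) (F : I -> subC S) z :
  subC_val (\sum_(i <- r) F i) z = \sum_(i <- r) subC_val (F i) z.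
Proof.
by elim: r => [|i r IH]; rewrite ?big_nil ?big_cons ?mkCK //= IH.
Qed.

Lemma state_pos phi a : state phi ->
  (forall z, 0 <= subC_val a z) -> 0 <= phi a.
Proof.
move=> h a0.
have aJ : star a = a.
  apply: subC_inj; apply: contC_eq => z; rewrite mkCK /=.
  by apply/CrealP; exact: ger0_real.
have phi_real : phi a \is Num.real.
  have := state_ge0 h (a + 1); rewrite starD aJ.
  have -> : star (1 : subC S) = 1 by rewrite -[LHS]mul1r -{1}[1]starK -starM mul1r starK.
  rewrite mulrDl mul1r mulrDr mulr1 !(stateD h) (state1 h) => h1.
  have h2 := state_ge0 h a; rewrite aJ in h2.
  have : phi (a * a) + phi a + (phi a + 1) - phi (a * a) - 1 \is Num.real.
    by rewrite !rpredB // ger0_real.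
  have -> : phi (a * a) + phi a + (phi a + 1) - phi (a * a) - 1 = 2%:R * phi a.
    by ring.
  by rewrite realMr // ?pnatr_eq0 // realn.
pose M : R := cnorm a.
have M0 : 0 <= M by exact: fCnorm_ge0.
have hM : normc (phi (M%:C%C *: 1 - a)) <= M.
  apply: le_trans (state_le h _) _; apply: fCnorm_le => z.
  have az : subC_val a z = (complex.Re (subC_val a z))%:C%C.
    by rewrite RRe_real // ger0_real.
  have az0 : 0 <= complex.Re (subC_val a z) by rewrite -ler0c -az.
  have azM : complex.Re (subC_val a z) <= M.
    apply: le_trans (fCnorm_ub (subC_val a) z).
    by apply: le_trans (ler_norm _) (normc_Re _).
  rewrite subC_valB !mkCK /= az mulr1 -rmorphB -lecR -normr_normc.
  by rewrite ger0_norm ?ler0c ?subr_ge0 // lecR gerBl.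
rewrite -scaleN1r (stateD h) !(stateZ h) (state1 h) mulr1 mulN1r in hM.
rewrite -(RRe_real phi_real) -rmorphB -lecR -normr_normc in hM.
rewrite -(RRe_real phi_real) ler0c.
move: hM; rewrite normr_normc lecR /= expr0n /= addr0 sqrtr_sqr ler_norml.
by case/andP => _; rewrite gerBl.
Qed.

Lemma state_ev z : state (fun a : subC S => subC_val a z).
Proof.
split=> [x y|a x|x|x|]; rewrite ?mkCK //=.
  by rewrite mulrC mulcJ_ge0.
exact: fCnorm_ub.
Qed.

End States.

Implicit Types t s r : seq (A * B).

Definition ften_val t (x : X) (y : Y) : R[i] :=
  \sum_(p <- t) subC_val p.1 x * subC_val p.2 y.

Lemma ften_valM s t x y :
  ften_val (ften_mul s t) x y = ften_val s x y * ften_val t x y.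
Proof.
rewrite /ften_val /ften_mul big_allpairs_dep /= big_distrlr /=.
apply: eq_bigr => p _; apply: eq_bigr => q _.
by rewrite /= mulrACA.
Qed.

Lemma ften_valJ t x y : ften_val (ften_star t) x y = (ften_val t x y)^*.
Proof.
rewrite /ften_val big_map /= rmorph_sum; apply: eq_bigr => p _.
by rewrite /= rmorphM.
Qed.

Lemma ften_eval_pos phi psi t : state phi -> state psi ->
  (forall x y, 0 <= ften_val t x y) -> 0 <= ften_eval phi psi t.
Proof.
move=> hphi hpsi t0.
have -> : ften_eval phi psi t = phi (\sum_(p <- t) psi p.2 *: p.1).
  rewrite state_sum //; apply: eq_bigr => p _.
  by rewrite (stateZ hphi) mulrC.
apply: state_pos => // x.
have -> : subC_val (\sum_(p <- t) psi p.2 *: p.1) x =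
    psi (\sum_(p <- t) subC_val p.1 x *: p.2).
  rewrite evA_sum state_sum //; apply: eq_bigr => p _.
  by rewrite mkCK /= (stateZ hpsi) mulrC.
apply: state_pos => // y.
have -> // : subC_val (\sum_(p <- t) subC_val p.1 x *: p.2) y = ften_val t x y.
by rewrite evA_sum; apply: eq_bigr => p _; rewrite mkCK.
Qed.

Fact ften_norm t :
  spatial_norm t (cnorm (\sum_(p <- t) ften_inl SB p.1 * ften_inr SA p.2)).
Proof.
set N := cnorm _.
have tE x y : subC_val (\sum_(p <- t) ften_inl SB p.1 * ften_inr SA p.2) (x, y)
    = ften_val t x y.
  by rewrite evA_sum; apply: eq_bigr.
have tN x y : normc (ften_val t x y) <= N by rewrite -tE; exact: fCnorm_ub.
have N0 : 0 <= N by exact: fCnorm_ge0.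
split.
  split=> // phi psi hphi hpsi r.
  set u := ften_mul _ _; set v := ften_mul _ _.
  pose sc (c : R[i]) := map (fun p : A * B => (c *: p.1, p.2)).
  have scE c w : ften_eval phi psi (sc c w) = c * ften_eval phi psi w.
    rewrite /ften_eval big_map big_distrr; apply: eq_bigr => p _ /=.
    by rewrite (stateZ hphi) mulrA.
  have scV c w x y : ften_val (sc c w) x y = c * ften_val w x y.
    rewrite /ften_val big_map big_distrr; apply: eq_bigr => p _ /=.
    by rewrite /= mulrA.
  rewrite -subr_ge0 -mulN1r -!scE.
  have -> : ften_eval phi psi (sc (N ^+ 2)%:C%C v) + ften_eval phi psi (sc (- 1) u)
      = ften_eval phi psi (sc (N ^+ 2)%:C%C v ++ sc (- 1) u).
    by rewrite /ften_eval big_cat.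
  apply: ften_eval_pos => // x y.
  have -> : ften_val (sc (N ^+ 2)%:C%C v ++ sc (- 1) u) x y =
      ften_val (sc (N ^+ 2)%:C%C v) x y + ften_val (sc (- 1) u) x y.
    by rewrite /ften_val big_cat.
  rewrite !scV mulN1r !ften_valM !ften_valJ ften_valM.
  set a := ften_val t x y; set b := ften_val r x y.
  have -> : (a * b)^* * (a * b) = (a * a^* ) * (b^* * b).
    by rewrite rmorphM mulrACA [a^* * a]mulrC.
  rewrite -mulrBl mulr_ge0 //; last by rewrite mulrC mulcJ_ge0.
  rewrite -sqr_normc normr_normc subr_ge0 -rmorphXn lecR.
  by rewrite lerXn2r ?nnegrE ?normc_ge0 // tN.
move=> M [M0 hM]; apply: fCnorm_le => -[x y]; rewrite tE.
have := hM _ _ (state_ev SA x) (state_ev SB y) [:: (1, 1)].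
have ev w : ften_eval (fun a : A => subC_val a x) (fun b : B => subC_val b y) w
   = ften_val w x y by [].
rewrite !ev !ften_valM !ften_valJ ften_valM.
have -> : ften_val [:: (1, 1)] x y = 1.
  by rewrite /ften_val big_seq1 /= mulr1.
rewrite conjC1 !mulr1 [_^* * _]mulrC -sqr_normc normr_normc -rmorphXn lecR.
by rewrite ler_pXn2r ?nnegrE ?normc_ge0.
Qed.

Definition function_tensor : spatial_tensor A B :=
  SpatialTensor (@ften_inl_hom R X Y SA SB) (@ften_inr_hom R X Y SA SB)
    (@ften_comm R X Y SA SB) ften_gen ften_norm.

End FunctionTensorNorm.

Section SetTypeTopology.
Context (U : topologicalType) (D : set U).

Lemma set_type_compact : compact D -> compact [set: set_type D].
Proof.
move=> cD F FF _.
have FD : (set_val @ F) D.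
  by apply: (@filterS _ F _ setT) => [x _|]; [exact: set_valP|exact: filterT].
have [p [Dp clp]] := cD (set_val @ F) _ FD.
exists (SigSub (mem_set Dp)); split=> // V W FV.
rewrite nbhsE => -[_ [[W' oW' <-] pW'] sW].
have FV' : (set_val @ F) (set_val @` V).
  by apply: (@filterS _ F _ V) => // x Vx; exists x.
have [_ [[x Vx <-] W'x]] : set_val @` V `&` W' !=set0.
  by apply: clp => //; apply: open_nbhs_nbhs.
by exists x; split=> //; apply: sW.
Qed.

Lemma set_type_continuous (Z : topologicalType) (f : Z -> set_type D) :
  continuous (set_val \o f) -> continuous f.
Proof.
move=> /continuousP cf; apply/continuousP => _ [W oW <-].
by rewrite -comp_preimage; exact: cf.
Qed.

End SetTypeTopology.

Section MatrixTopology.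
Context (R : realType).

Lemma continuous_mx (Z : topologicalType) (p q : nat) (f : Z -> 'M[R]_(p, q)) :
  (forall i j, continuous (fun z => f z i j : R)) -> continuous f.
Proof.
move=> cf z A /= [P hP sPA].
have : \forall y \near z, forall ij : 'I_p * 'I_q, P ij.1 ij.2 (f y ij.1 ij.2).
  by apply: filter_forall => -[i j]; exact: (cf i j z _ (hP i j)).
by apply: filterS => y hy; apply: sPA => i j; exact: (hy (i, j)).
Qed.

Lemma continuous_sumR (Z : topologicalType) (I : Type) (r : seq I)
    (F : I -> Z -> R) :
  (forall i, continuous (F i)) -> continuous (fun z => \sum_(i <- r) F i z).
Proof.
move=> cF; elim: r => [|i r IH] z.
  by under eq_fun do rewrite big_nil; exact: cvg_cst.
by under eq_fun do rewrite big_cons; apply: cvgD; [exact: cF|exact: IH].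
Qed.

Lemma continuous_mulR (Z : topologicalType) (f g : Z -> R) :
  continuous f -> continuous g -> continuous (fun z => f z * g z).
Proof. by move=> cf cg z; apply: cvgM; [exact: cf|exact: cg]. Qed.

End MatrixTopology.

Section OrthogonalGroup.
Context (R : realType) (n : nat).

Definition orth : set 'M[R]_n := [set M | M^T *m M = 1%:M].

Lemma orth_entry M i j : orth M -> `|M i j| <= 1.
Proof.
move=> hM; have : (M^T *m M) j j = 1 by rewrite hM mxE eqxx.
rewrite mxE (bigD1 i) //= mxE -expr2 => h.
rewrite -(@ler_pXn2r _ 2) ?nnegrE // expr1n real_normK ?num_real // -h.
by rewrite lerDl sumr_ge0 // => k _; rewrite mxE -expr2 sqr_ge0.
Qed.

Lemma orth_compact : compact orth.
Proof.
pose K : set 'rV[R]_(n * n) := [set v | forall k, `[(-1 : R), 1]%classic (v ord0 k)].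
have cK : compact K.
  apply: (@rV_compact R (n * n) (fun _ => `[(-1 : R), 1]%classic)) => _.
  exact: segment_compact.
have cvec : continuous (@vec_mx R n n).
  by apply: continuous_mx => i j; under eq_fun do rewrite mxE; exact: coord_continuous.
apply: (@subclosed_compact _ _ (@vec_mx R n n @` K)).
- have -> : orth = \bigcap_(ij in [set: 'I_n * 'I_n])
      ((fun M : 'M[R]_n => (M^T *m M) ij.1 ij.2) @^-1` [set (1%:M : 'M[R]_n) ij.1 ij.2]).
    rewrite eqEsubset; split=> [M hM ij _|M hM]; first by rewrite /= hM.
    by apply/matrixP => i j; exact: (hM (i, j)).
  apply: closed_bigI => -[i j] _ /=.
  apply: (@preimage_closed _ R); last exact: closed_eq.
  move=> M _; move: M; under eq_fun do rewrite mxE.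
  apply: continuous_sumR => k; under eq_fun do rewrite mxE.
  by apply: continuous_mulR; exact: coord_continuous.
- by apply: continuous_compact => //; exact: continuous_subspaceT.
- move=> M hM; exists (mxvec M); last exact: mxvecK.
  move=> k; case/mxvec_indexP: k => i j.
  by rewrite mxvecE /= in_itv /= -ler_norml; exact: orth_entry.
Qed.

Lemma orth1 : orth 1%:M.
Proof. by rewrite /orth /= trmx1 mul1mx. Qed.

Lemma orth_mul M N : orth M -> orth N -> orth (M *m N).
Proof.
by rewrite /orth /= => hM hN; rewrite trmx_mul mulmxA -(mulmxA N^T) hM mulmx1.
Qed.

Definition orth_space : compactSpace :=
  @CompactSpace (set_type orth) (SigSub (mem_set orth1))
    (set_type_compact orth_compact).

Local Notation O := orth_space.

Definition orth_val (g : O) : 'M[R]_n := set_val g.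

Lemma orth_valP g : orth (orth_val g).
Proof. exact: set_valP. Qed.

Lemma orth_val_continuous : continuous orth_val.
Proof. exact: (@initial_continuous _ _ (set_val : set_type orth -> _)). Qed.

Lemma orth_coord_continuous i j : continuous (fun g => orth_val g i j).
Proof.
move=> g; apply: (@continuous_comp _ _ _ orth_val (fun M : 'M[R]_n => M i j)).
  exact: orth_val_continuous.
exact: coord_continuous.
Qed.

Definition orth_mulg (gh : prod_space O O) : O :=
  SigSub (mem_set (orth_mul (orth_valP gh.1) (orth_valP gh.2))).

Lemma orth_mulgE gh : orth_val (orth_mulg gh) = orth_val gh.1 *m orth_val gh.2.
Proof. by []. Qed.

Lemma orth_mulg_continuous : continuous orth_mulg.
Proof.
apply: set_type_continuous; apply: continuous_mx => i j.
rewrite (_ : (fun _ => _) =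
  fun gh : prod_space O O => \sum_k orth_val gh.1 i k * orth_val gh.2 k j); last first.
  by apply/funext => gh /=; rewrite mxE.
apply: continuous_sumR => k; apply: continuous_mulR => gh.
- apply: (@continuous_comp _ _ _ (fst : O * O -> O) (fun g => orth_val g i k)).
    exact: cvg_fst.
  exact: orth_coord_continuous.
- apply: (@continuous_comp _ _ _ (snd : O * O -> O) (fun g => orth_val g k j)).
    exact: cvg_snd.
  exact: orth_coord_continuous.
Qed.

End OrthogonalGroup.

Section TensorPowers.
Context (R : realType) (n : nat) (z : word).
Implicit Types M N : 'M[R]_n.

Definition mxpow M : mindex 'I_n z -> mindex 'I_n z -> R :=
  tpow (fun _ => fun_of_matrix M) z.

Lemma mxpow_mul M N i j : mxpow (M *m N) i j = \sum_k mxpow M i k * mxpow N k j.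
Proof.
rewrite /mxpow /tpow.
under eq_bigr do rewrite mxE.
rewrite bigA_distr_bigA /=; apply: eq_bigr => k _.
by rewrite big_split.
Qed.

Lemma mxpow1 i j : mxpow 1%:M i j = (i == j)%:R.
Proof.
rewrite /mxpow /tpow; have [->|/eqP ij] := eqVneq i j.
  by apply: big1 => k _; rewrite mxE eqxx.
have [k /eqP kij] : exists k, i k <> j k.
  by apply: contra_notP ij => h; apply/ffunP => k; apply: contra_notP h => hk; exists k.
by rewrite (bigD1 k) //= mxE (negbTE kij) mul0r.
Qed.

Lemma mxpowT M i j : mxpow M^T i j = mxpow M j i.
Proof. by apply: eq_bigr => k _; rewrite mxE. Qed.

End TensorPowers.

Section OrthogonalQuantumGroup.
Context (R : realType) (n : nat).
Local Notation O := (orth_space R n).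

Fact orth_coord_fun_continuous i j :
  continuous ((fun g => (orth_val g i j)%:C%C) : O -> R[i]^o).
Proof.
apply/continuousCP => g e e0.
have /cvgrPdist_lt /(_ e e0) := @orth_coord_continuous R n i j g.
apply: filterS => h; rewrite -rmorphB /= expr0n /= addr0 sqrtr_sqr.
by [].
Qed.

Definition orth_u (i j : 'I_n) : contC R O :=
  ContC (@orth_coord_fun_continuous i j).

Context (z : word).

Definition orth_uz : mindex 'I_n z -> mindex 'I_n z -> contC R O :=
  tpow (by_colour orth_u (mbar orth_u)) z.

Definition orth_sub : cstar_sub (contC R O) :=
  CStarSub (cstar_gen_subalg (entries orth_uz)).

Local Notation A := (subC orth_sub).

Fact orth_uz_in i j : orth_sub (orth_uz i j).
Proof. by apply: cstar_gen_sub; exists i, j. Qed.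

Definition orth_fund (i j : mindex 'I_n z) : A := mkC (orth_uz_in i j).

Lemma contC_prod (I : Type) (r : seq I) (F : I -> contC R O) g :
  (\prod_(i <- r) F i) g = \prod_(i <- r) F i g.
Proof. by elim: r => [|i r IH]; rewrite ?big_nil ?big_cons //= IH. Qed.

Lemma orth_uzE i j g : orth_uz i j g = (mxpow (orth_val g) i j)%:C%C.
Proof.
rewrite contC_prod rmorph_prod; apply: eq_bigr => k _.
by case: (nth White z k) => //; exact: conjc_real.
Qed.

Lemma orth_fundJ i j : star (orth_fund i j) = orth_fund i j.
Proof.
apply: subC_inj; apply: contC_eq => g; rewrite !mkCK /= orth_uzE.
exact: conjc_real.
Qed.

Lemma orth_fund_bar i j : mbar orth_fund i j = orth_fund i j.
Proof. exact: orth_fundJ. Qed.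

Lemma orth_val_tr g : orth_val g *m (orth_val g)^T = 1%:M :> 'M[R]_n.
Proof. by apply: mulmx1C; exact: (@orth_valP R n g). Qed.

Lemma orth_fundE i j g :
  subC_val (orth_fund i j) g = (mxpow (orth_val g) i j)%:C%C.
Proof. by rewrite mkCK orth_uzE. Qed.

Lemma midm_val i j g :
  subC_val (@midm A (mindex 'I_n z) i j) g = ((i == j)%:R : R)%:C%C.
Proof. by rewrite /midm; case: (i == j). Qed.

Fact orth_fund_unitary : munitary orth_fund.
Proof.
split=> i j; apply: subC_inj; apply: contC_eq => g; rewrite /mmul evA_sum midm_val.
  transitivity (\sum_k (mxpow (orth_val g) i k * mxpow (orth_val g)^T k j)%:C%C).
    apply: eq_bigr => k _.
    rewrite /madj orth_fundJ mxpowT rmorphM.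
    transitivity (subC_val (orth_fund i k) g * subC_val (orth_fund j k) g) => //.
    by rewrite !orth_fundE.
  by rewrite -rmorph_sum -mxpow_mul orth_val_tr mxpow1.
transitivity (\sum_k (mxpow (orth_val g)^T i k * mxpow (orth_val g) k j)%:C%C).
  apply: eq_bigr => k _.
  rewrite /madj orth_fundJ mxpowT rmorphM.
  transitivity (subC_val (orth_fund k i) g * subC_val (orth_fund k j) g) => //.
  by rewrite !orth_fundE.
by rewrite -rmorph_sum -mxpow_mul (@orth_valP R n g) mxpow1.
Qed.

Fact orth_fund_inv : minvertible (mbar orth_fund).
Proof.
exists (madj orth_fund); have [h1 h2] := orth_fund_unitary.
split=> i j; [rewrite -h1|rewrite -h2]; apply: eq_bigr => k _;
  by rewrite orth_fund_bar.
Qed.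

Fact orth_fund_gen : cstar_gen (entries orth_fund) = setT.
Proof.
apply: subC_gen => _ [i [j ->]].
by exists (orth_fund i j); [exists i, j|rewrite mkCK].
Qed.

Local Notation T := (function_tensor orth_sub orth_sub).

Fact orth_pull_continuous (f : contC R O) :
  continuous ((fun gh => f (orth_mulg gh)) : prod_space O O -> R[i]^o).
Proof.
move=> gh; apply: (@continuous_comp _ _ _ (@orth_mulg R n) (f : O -> R[i]^o)).
  exact: orth_mulg_continuous.
exact: cfunP.
Qed.

(* f |-> ((g, h) |-> f (g h)), the restriction of which is the
   comultiplication of O_n^z. *)
Definition orth_pull (f : contC R O) : contC R (prod_space O O) :=
  ContC (@orth_pull_continuous f).

Lemma orth_pull_uz i j : orth_pull (orth_uz i j) =
  subC_val (\sum_k st_inl T (orth_fund i k) * st_inr T (orth_fund k j)).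
Proof.
apply: contC_eq => gh; rewrite evA_sum /= orth_uzE orth_mulgE mxpow_mul rmorph_sum.
by apply: eq_bigr => k _; rewrite rmorphM /= !orth_uzE.
Qed.

Fact orth_pull_in (a : A) : ften_sub orth_sub orth_sub (orth_pull (subC_val a)).
Proof.
pose V : set (contC R O) := fun f => ften_sub orth_sub orth_sub (orth_pull f).
have hS := csubP (ften_sub orth_sub orth_sub).
have hV : cstar_subalg V.
  split; first split.
  - by rewrite /V (_ : orth_pull 1 = 1); [exact: (ssub1 hS)|exact: contC_eq].
  - move=> f g Vf Vg; rewrite /V (_ : orth_pull _ = orth_pull f + orth_pull g).
      exact: (ssubD hS).
    exact: contC_eq.
  - move=> c f Vf; rewrite /V (_ : orth_pull _ = c *: orth_pull f).
      exact: (ssubZ hS).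
    exact: contC_eq.
  - move=> f g Vf Vg; rewrite /V (_ : orth_pull _ = orth_pull f * orth_pull g).
      exact: (ssubM hS).
    exact: contC_eq.
  - move=> f Vf; rewrite /V (_ : orth_pull _ = star (orth_pull f)).
      exact: (ssubJ hS).
    exact: contC_eq.
  move=> u l Vu ul; apply: (csub_closed hS (u := orth_pull \o u)) => // e /ul.
  apply: filterS => k; apply: le_lt_trans.
  apply: fCnorm_le => gh; exact: (fCnorm_ub (u k - l) (orth_mulg gh)).
apply: (subC_valP a) hV _ => _ [i [j ->]].
by rewrite /V orth_pull_uz; exact: subC_valP.
Qed.

Definition orth_comul (a : A) : T := mkC (orth_pull_in a).

Fact orth_comul_hom : star_hom orth_comul.
Proof. by split=> *; apply: subC_inj; apply: contC_eq. Qed.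

Fact orth_comul_fund i j : orth_comul (orth_fund i j) =
  \sum_k st_inl T (orth_fund i k) * st_inr T (orth_fund k j).
Proof. by apply: subC_inj; rewrite -orth_pull_uz mkCK. Qed.

(* O_n^z; since z = White^m in the main statement, only the letter White of
   by_colour matters there. *)
Definition On_z : cmqg R (mindex 'I_n z) :=
  @CMQG R (mindex 'I_n z) A orth_fund orth_fund_unitary orth_fund_inv
    orth_fund_gen T orth_comul orth_comul_hom orth_comul_fund.

End OrthogonalQuantumGroup.

(* Main.v *)
Require Import Defs.
From mathcomp Require Import all_boot reals.
From mathcomp Require Import all_order all_algebra ring lra.

(** Both Hom spaces coincide once [u^z] is indexed by [{ffun 'I_m -> 'I_n}]: the
    ones of [O_n^z] consist of the tensors invariant under [O_n], so what has to
    be shown is that invariant tensors are spanned by pair partitions (Brauer).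

    Subtract from an invariant tensor its orthogonal projection to the span of
    the pair partitions.  By induction on the number N of tensor legs, all
    contractions of the difference X vanish.  Let [E_ab] act on tensors as a
    derivation.  Invariance under the rotations of the (a, b)-plane gives
    [E_ab X = E_ba X], whence, contractions being zero,
      [\sum_(a, b) |E_ab X|^2 = \sum_(a, b) <E_ab X, E_ba X> = N |X|^2].
    Invariance under sign changes of coordinates forces each value to occur an
    even number of times in a multi-index supporting X, so the terms with a = b
    alone contribute at least [2 N |X|^2].  Hence X = 0. *)

Set Implicit Arguments.
Unset Strict Implicit.
Unset Printing Implicit Defensive.

Import Order.TTheory GRing.Theory Num.Theory.
Local Open Scope ring_scope.

(** * Tensors as functions of multi-indices *)

Lemma ffun_neq (P : finType) (C : eqType) (v w : {ffun P -> C}) :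
  v != w -> exists k, v k != w k.
Proof.
move=> vw; apply/existsP; apply: contraNT vw; rewrite negb_exists => /forallP h.
by apply/eqP/ffunP => k; have := h k; rewrite negbK => /eqP.
Qed.

Section Update.
Context (P C : finType).
Implicit Types (w : {ffun P -> C}) (k l : P) (c d : C).

Definition upd w k c : {ffun P -> C} := [ffun l => if l == k then c else w l].

Lemma updE w k c l : upd w k c l = if l == k then c else w l.
Proof. by rewrite ffunE. Qed.

Lemma upd_same w k c : upd w k c k = c.
Proof. by rewrite updE eqxx. Qed.

Lemma upd_neq w k c l : l != k -> upd w k c l = w l.
Proof. by rewrite updE => /negbTE ->. Qed.

Lemma upd_upd w k c d : upd (upd w k c) k d = upd w k d.
Proof. by apply/ffunP => l; rewrite !updE; case: eqP. Qed.

Lemma upd_id w k : upd w k (w k) = w.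
Proof. by apply/ffunP => l; rewrite updE; case: eqP => [->|]. Qed.

Lemma updC w k l c d : k != l -> upd (upd w k c) l d = upd (upd w l d) k c.
Proof.
move=> kl; apply/ffunP => q; rewrite !updE.
by have [->|//] := eqVneq q l; rewrite eq_sym (negbTE kl).
Qed.

(** Exchanging [c] with the value of [w] at [k] is an involution on the pairs [(w, c)]. This
    replaces splitting off a coordinate: the index type never changes, at the cost of a factor
    [#|C|]. *)
Lemma sum_upd (V : nmodType) k (g : {ffun P -> C} -> V) :
  \sum_w \sum_c g (upd w k c) = (\sum_w g w) *+ #|C|.
Proof.
pose h (p : {ffun P -> C} * C) := (upd p.1 k p.2, p.1 k).
have hK : involutive h by case=> w c; rewrite /h /= upd_same upd_upd upd_id.
rewrite pair_big /= (reindex_inj (inv_inj hK)) /=.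
under eq_bigr => p _ do rewrite upd_upd upd_id.
rewrite -(pair_big xpredT xpredT (fun w _ => g w)) /= -sumrMnl.
by apply: eq_bigr => w _; rewrite sumr_const.
Qed.

Lemma sum_upd2 (V : nmodType) k l (g : {ffun P -> C} -> V) :
  \sum_w \sum_c \sum_d g (upd (upd w k c) l d) = (\sum_w g w) *+ (#|C| * #|C|).
Proof.
by rewrite (sum_upd k (fun w => \sum_d g (upd w l d))) sum_upd mulrnA.
Qed.

End Update.

(** * Pair partitions of a set of legs, and the multi-indices constant on their blocks *)

Section Pairings.
Context (P : finType).
Implicit Types (U : {set P}) (p : {set {set P}}).

Definition pairing U p := finset.partition p U && [forall B in p, #|B| == 2].

Lemma pairing_add U p i j : i != j -> i \in U -> j \in U ->
  pairing (U :\ i :\ j) p -> pairing U ([set i; j] |: p).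
Proof.
move=> ij iU jU /andP[pP /forall_inP p2]; apply/andP; split; last first.
  by apply/forall_inP => B /setU1P[->|/p2//]; rewrite cards2 ij.
have UE : U = [set i; j] :|: (U :\ i :\ j).
  apply/setP => x; rewrite !inE; have [->|] := eqVneq x i; first by rewrite iU.
  by have [->|] := eqVneq x j; first by rewrite jU.
rewrite UE; apply: partitionU1; rewrite -?card_gt0 ?cards2 ?ij //.
by rewrite disjoints_subset; apply/subsetP => x /set2P[] ->; rewrite !inE eqxx ?andbF.
Qed.

Lemma pairing_pick U p i : pairing U p -> i \in U ->
  exists j p', [/\ i != j, j \in U, pairing (U :\ i :\ j) p' & p = [set i; j] |: p'].
Proof.
move=> /andP[pP /forall_inP p2] iU; have /and3P[/eqP pU pT p0] := pP.
pose B := pblock p i.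
have Bp : B \in p by rewrite pblock_mem // pU.
have iB : i \in B by rewrite mem_pblock pU.
have /cards2P[a [b [ab EB]]] := p2 _ Bp.
have [j [ij {a b ab}EB]] : exists j, i != j /\ B = [set i; j].
  move: iB; rewrite EB => /set2P[] ->; first by exists b.
  by exists a; rewrite eq_sym setUC.
exists j, (p :\ B); split=> //.
- by rewrite -pU; apply/bigcupP; exists B => //; rewrite EB !inE eqxx orbT.
- apply/andP; split; last by apply/forall_inP => A /setD1P[_ /p2].
  have := partitionD1 pP Bp; rewrite EB.
  have -> // : U :\: [set i; j] = U :\ i :\ j.
  by apply/setP => x; rewrite !inE negb_or andbA [(x != j) && _]andbC.
- by rewrite -EB setD1K.
Qed.

Lemma pairing0 : pairing set0 set0.
Proof.
by rewrite /pairing partition_set0 eqxx; apply/forall_inP => B; rewrite inE.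
Qed.

Lemma pairing_coverP U p k B : pairing U p -> B \in p -> k \in B -> k \in U.
Proof.
by move=> /andP[/and3P[/eqP <- _ _] _] Bp kB; apply/bigcupP; exists B.
Qed.

Context (C : finType).
Implicit Types (w v : {ffun P -> C}).

Definition matches p w : bool :=
  [forall B in p, forall a in B, forall b in B, w a == w b].

Lemma matches0 w : matches set0 w.
Proof. by apply/forall_inP => B; rewrite inE. Qed.

Lemma matches_add p i j w :
  matches ([set i; j] |: p) w = (w i == w j) && matches p w.
Proof.
apply/idP/idP => [/forall_inP h|/andP[/eqP wij /forall_inP h]].
  apply/andP; split; last by apply/forall_inP => B Bp; apply: h; rewrite setU1r.
  have /forall_inP/(_ i) := h _ (setU11 _ _); rewrite !inE eqxx => /(_ isT).
  by move/forall_inP/(_ j); rewrite !inE eqxx orbT; apply.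
apply/forall_inP => B /setU1P[->|/h//].
by apply/forall_inP => a /set2P[] ->; apply/forall_inP => b /set2P[] ->; rewrite ?wij.
Qed.

Lemma matches_local U p v w : pairing U p -> {in U, v =1 w} ->
  matches p v = matches p w.
Proof.
move=> hp vw; apply: eq_forallb_in => B Bp; apply: eq_forallb_in => a aB.
apply: eq_forallb_in => b bB.
by rewrite !vw //; [exact: pairing_coverP hp Bp bB|exact: pairing_coverP hp Bp aB].
Qed.

End Pairings.

(** * Invariant tensors orthogonal to the pairings vanish *)

Section Traceless.
Context (F : realFieldType) (P C : finType).
Implicit Types (U : {set P}) (X : {ffun P -> C} -> F) (w : {ffun P -> C}).

Definition mult U w (a : C) : nat := #|[set k in U | w k == a]|.

(** The matrix unit [E_ab] acting as a derivation on the legs in [U]; the legs outside [U] are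
    spectators. *)
Definition shift U X (a b : C) w : F := \sum_(k in U | w k == a) X (upd w k b).

(** Infinitesimal invariance: the antisymmetric matrices [E_ab - E_ba] annihilate [X]. *)
Definition so_inv U X : Prop := forall a b w, shift U X a b w = shift U X b a w.

Definition even_supp U X : Prop := forall a w, odd (mult U w a) -> X w = 0.

(** The contraction of the legs [i] and [j], kept as a tensor on all of [P] that no longer depends
    on these two legs. *)
Definition contr (i j : P) X w : F := \sum_c X (upd (upd w i c) j c).

Lemma sum_mult U w : \sum_a mult U w a = #|U|.
Proof.
rewrite -sum1_card (partition_big w xpredT) //=; apply: eq_bigr => a _.
by rewrite sum1_card; apply: eq_card => k; rewrite !inE.
Qed.

Lemma shift_diag U X a w : shift U X a a w = X w *+ mult U w a.
Proof.
rewrite /shift (eq_bigr (fun _ => X w)) => [|k /andP[_ /eqP <-]]; last first.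
  by rewrite upd_id.
by rewrite sumr_const; congr (_ *+ _); apply: eq_card => k; rewrite !inE.
Qed.

(** A leg [k] contributes only for [a = w k] and a leg [l] only for [b = w l], so the sums over [a]
    and [b] merely sort the legs by their values. *)
Lemma sum_shiftM U X w : \sum_a \sum_b shift U X a b w * shift U X b a w =
  \sum_(k in U) \sum_(l in U) X (upd w k (w l)) * X (upd w l (w k)).
Proof.
rewrite [RHS](partition_big w xpredT) //=; apply: eq_bigr => a _.
rewrite [RHS](eq_bigr (fun k => \sum_b \sum_(l in U | w l == b)
    X (upd w k b) * X (upd w l a))) => [|k /andP[_ /eqP <-]]; last first.
  rewrite (partition_big w xpredT) //=; apply: eq_bigr => b _.
  by apply: eq_bigr => l /andP[_ /eqP ->].
rewrite exchange_big; apply: eq_bigr => b _ /=.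
by rewrite /shift big_distrlr.
Qed.

(** Let [w] take the values [c] at [k] and [d] at [l]. The first factor then has [d] at both legs,
    the second has [c] at both, so the sum over [c] and [d] is the square of a contraction. *)
Lemma sum_swap_contr X k l : k != l -> (forall w, contr k l X w = 0) ->
  \sum_w X (upd w k (w l)) * X (upd w l (w k)) = 0.
Proof.
move=> kl h; have [C0|C0] := posnP #|C|.
  by apply: big1 => w _; have := card0_eq C0 (w k).
apply/eqP; rewrite -[_ == 0]orFb -(_ : (#|C| * #|C|)%N == 0%N = false); last first.
  by rewrite muln_eq0 gtn_eqF.
rewrite -mulrn_eq0 -(sum_upd2 k l); apply/eqP/big1 => w _.
transitivity (contr k l X w * contr k l X w); last by rewrite h mul0r.
rewrite /contr mulr_sumr; apply: eq_bigr => c _.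
rewrite mulr_suml; apply: eq_bigr => d _.
have -> : upd (upd w k c) l d k = c by rewrite upd_neq // upd_same.
by rewrite upd_same upd_upd (updC w c d kl) upd_upd -(updC w d d kl) mulrC.
Qed.

Lemma traceless_eq0 U X : U != set0 -> so_inv U X -> even_supp U X ->
  {in U &, forall k l, k != l -> forall w, contr k l X w = 0} ->
  forall w, X w = 0.
Proof.
move=> U0 sX eX cX.
pose S := \sum_w X w ^+ 2.
have S0 : 0 <= S by apply: sumr_ge0 => w _; exact: sqr_ge0.
(* By [sum_swap_contr] only the terms with [k = l] survive, and each leg of [U] gives one copy of
   [S]. *)
have H1 : \sum_w \sum_a \sum_b shift U X a b w ^+ 2 = S *+ #|U|.
  transitivity (\sum_w \sum_a \sum_b shift U X a b w * shift U X b a w).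
    by do 3!(apply: eq_bigr => ? _); rewrite [in RHS]sX -expr2 sX.
  under eq_bigr => w _ do rewrite sum_shiftM.
  rewrite exchange_big -sumr_const; apply: eq_bigr => k kU /=.
  rewrite exchange_big (bigD1 k) //= [X in _ + X]big1 ?addr0.
    by apply: eq_bigr => w _; rewrite upd_id -expr2.
  by move=> l /andP[lU lk]; apply: sum_swap_contr; last apply: cX;
    rewrite // eq_sym.
(* Keep only [a = b], where the shift multiplies [X w] by a multiplicity [m]. If [X w] is nonzero,
   then [m] is even, so [m ^ 2 >= 2 * m]; the multiplicities add up to [#|U|]. *)
have H2 : (S *+ #|U|) *+ 2 <= S *+ #|U|.
  rewrite -{2}H1 /S -!sumrMnl; apply: ler_sum => w _.
  rewrite -mulrnA -(sum_mult U w) big_distrl /= -sumrMnr.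
  apply: ler_sum => a _; rewrite (bigD1 a) //=.
  apply: ler_wpDr; first by apply: sumr_ge0 => b _; exact: sqr_ge0.
  rewrite shift_diag; have [e|/negPn e] := boolP (odd (mult U w a)).
    by rewrite (eX _ _ e) expr0n /= !mul0rn expr0n.
  rewrite exprMn_n; apply: ler_wpMn2l; first exact: sqr_ge0.
  by case: (mult U w a) e => [|[|e]] // _; rewrite expnS expn1 leq_mul2l orbT.
have S_eq0 : S = 0.
  have : S *+ #|U| <= 0 by move: H2; rewrite mulr2n gerDl.
  rewrite pmulrn_lle0 ?card_gt0 // => S_le0.
  by apply: le_anti; rewrite S_le0.
move=> w; apply/eqP; rewrite -sqrf_eq0; apply/eqP.
by apply: (psumr_eq0P _ S_eq0) => // v _; exact: sqr_ge0.
Qed.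

Lemma contr_so_inv U X i j : i != j -> i \in U -> j \in U ->
  so_inv U X -> so_inv (U :\ i :\ j) (contr i j X).
Proof.
move=> ij iU jU sX a b w.
pose W c := upd (upd w i c) j c.
have Wi c : W c i = c by rewrite /W upd_neq // upd_same.
have Wj c : W c j = c by rewrite /W upd_same.
have sum_delta (d : C) (G : C -> F) : \sum_c (if c == d then G c else 0) = G d.
  by rewrite -big_mkcond big_pred1_eq.
(* Leaving out the legs [i] and [j] removes two terms from the shift of [X]; their sum is symmetric
   in [d] and [e], hence harmless. *)
have E d e : shift (U :\ i :\ j) (contr i j X) d e w =
    \sum_c shift U X d e (W c)
    - (X (upd (upd w i e) j d) + X (upd (upd w i d) j e)).
  rewrite {2}/shift; under [X in _ = X - _]eq_bigr => c _.
    rewrite big_mkcondr (big_setD1 i) //= (big_setD1 j) //=; last first.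
      by rewrite !inE eq_sym ij.
    rewrite Wi Wj; over.
  rewrite !big_split /= !sum_delta.
  have -> : upd (W d) i e = upd (upd w i e) j d.
    by rewrite /W (updC w d d ij) upd_upd -(updC w e d ij).
  have -> : upd (W d) j e = upd (upd w i d) j e by rewrite /W upd_upd.
  rewrite addrA [in RHS]addrC addrK exchange_big /shift big_mkcondr /=.
  apply: eq_bigr => k; rewrite !inE => /and3P[kj ki kU].
  under [in RHS]eq_bigr => c _ do rewrite /W upd_neq // upd_neq //.
  case: eqP => // _; last by rewrite big1.
  apply: eq_bigr => c _; by rewrite /W (updC w e c ki) (updC _ e c kj).
rewrite !E; congr (_ - _); last by rewrite addrC.
by apply: eq_bigr => c _; exact: sX.
Qed.

(** The two contracted legs carry the same value, so each multiplicity changes by 0 or 2 and keeps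
    its parity. *)
Lemma contr_even_supp U X i j : i != j -> i \in U -> j \in U ->
  even_supp U X -> even_supp (U :\ i :\ j) (contr i j X).
Proof.
move=> ij iU jU eX a w e; apply: big1 => c _; apply: (eX a).
suff -> : mult U (upd (upd w i c) j c) a =
    ((c == a).*2 + mult (U :\ i :\ j) w a)%N by rewrite oddD odd_double.
have E V v : mult V v a = (\sum_(k in V) (v k == a))%N.
  by rewrite /mult -sum1dep_card big_mkcondr.
rewrite !E (big_setD1 i) //= (big_setD1 j) ?inE ?jU ?[j == i]eq_sym ?ij //=.
rewrite upd_same upd_neq // upd_same addnA addnn; congr (_ + _)%N.
apply: eq_bigr => k; rewrite !inE => /and3P[kj ki _].
by rewrite !upd_neq.
Qed.

(** Since contractions keep the index type [P], this records which legs are still live. *)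
Definition depends_on U X : Prop :=
  forall v w : {ffun P -> C}, {in U, v =1 w} -> X v = X w.

Lemma contr_depends_on U X i j :
  depends_on U X -> depends_on (U :\ i :\ j) (contr i j X).
Proof.
move=> dX v w vw; apply: eq_bigr => c _; apply: dX => k kU; rewrite !updE.
case: eqP => // /eqP kj; case: eqP => // /eqP ki; apply: vw.
by rewrite !inE kj ki.
Qed.

(** The sum is the inner product of [X] with the indicator tensor of [p]. *)
Definition orth_pairings U X : Prop :=
  forall p, pairing U p -> \sum_(w | matches p w) X w = 0.

(** The inner product of the contraction with [p] is, up to the factor [#|C| ^ 2], that of [X] with
    [p] enlarged by the block [[set i; j]]. *)
Lemma contr_orth_pairings U X i j : i != j -> i \in U -> j \in U ->
  orth_pairings U X -> orth_pairings (U :\ i :\ j) (contr i j X).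
Proof.
move=> ij iU jU oX p hp.
pose g w := if matches ([set i; j] |: p) w then X w else 0.
transitivity ((\sum_w g w) *+ (#|C| * #|C|)); last first.
  by rewrite /g -big_mkcond oX ?mul0rn //; exact: pairing_add.
rewrite -(sum_upd2 i j) big_mkcond; apply: eq_bigr => w _.
have E c d : g (upd (upd w i c) j d) =
    if d == c then if matches p w then X (upd (upd w i c) j c) else 0 else 0.
  rewrite /g matches_add upd_same upd_neq // upd_same eq_sym.
  case: eqP => //= ->; rewrite (matches_local (w := w) hp) // => k.
  by rewrite !inE => /and3P[kj ki _]; rewrite !upd_neq.
transitivity (\sum_c if matches p w then X (upd (upd w i c) j c) else 0).
  by case: ifP => // _; rewrite big1.
apply: eq_bigr => c _; under eq_bigr => d _ do rewrite E.
by rewrite -big_mkcond big_pred1_eq.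
Qed.

Lemma orth_pairings_eq0 U X : depends_on U X -> so_inv U X -> even_supp U X ->
  orth_pairings U X -> forall w, X w = 0.
Proof.
have [N] := ubnP #|U|; elim: N => // N IH in U X * => leN dX sX eX oX w.
have [U0|U0] := eqVneq U set0; last first.
  apply: (traceless_eq0 U0 sX eX) => k l kU lU kl v.
  apply: (IH (U :\ k :\ l)).
  - move: leN; rewrite ltnS; apply: leq_trans.
    apply: leq_ltn_trans (proper_card (properD1 kU)).
    by apply: subset_leq_card; exact: subsetDl.
  - exact: contr_depends_on.
  - exact: contr_so_inv.
  - exact: contr_even_supp.
  - exact: contr_orth_pairings.
(* Without live legs [X] is constant, and orthogonality to the empty pairing says that its values
   sum to zero. *)
have := oX set0; rewrite {1}U0 => /(_ (pairing0 P)).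
rewrite (eq_bigl xpredT) => [|v]; last exact: matches0.
rewrite (eq_bigr (fun _ => X w)) => [|v _]; last by apply: dX => k; rewrite U0 inE.
rewrite sumr_const => /eqP; rewrite mulrn_eq0 => /orP[|/eqP//].
by rewrite -leqn0 leqNgt; case/negP; apply/card_gt0P; exists w.
Qed.

End Traceless.

(** * Brauer's theorem *)

Lemma deriv_prod (A : comNzRingType) (P : finType) (f : P -> {poly A}) :
  (\prod_k f k)^`() = \sum_k (f k)^`() * \prod_(l | l != k) f l.
Proof.
suff H (r : seq P) : uniq r -> (\prod_(k <- r) f k)^`() =
    \sum_(k <- r) (f k)^`() * \prod_(l <- r | l != k) f l.
  exact: H (index_enum_uniq P).
elim: r => [_|k r IH /= /andP[kr /IH E]]; first by rewrite !big_nil derivC.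
rewrite !big_cons derivM E eqxx; congr (_ * _ + _).
  rewrite [RHS]big_seq_cond [LHS]big_seq; apply: eq_bigl => l.
  by have [->|] := eqVneq l k; rewrite ?(negbTE kr) ?andbT.
rewrite mulr_sumr !big_seq; apply: eq_bigr => l lr.
have kl : k != l by apply: contraNneq kr => ->.
by rewrite [in RHS]big_cons kl [RHS]mulrCA.
Qed.

Lemma poly_nat_eq0 (F : numDomainType) (p : {poly F}) :
  (forall k : nat, p.[k%:R] = 0) -> p = 0.
Proof.
move=> p0; apply/eqP; apply: contraT => pn0.
have := @max_poly_roots F p [seq k%:R | k <- iota 0 (size p)] pn0.
rewrite size_map size_iota ltnn => -> //.
  by apply/allP => _ /mapP[k _ ->]; exact/rootP.
by rewrite map_inj_uniq ?iota_uniq //; exact: mulrIn (oner_neq0 F).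
Qed.

(** The Kronecker deltas force [v] to agree with [w] away from [k]. This evaluates the terms that
    the Leibniz rule produces at the identity matrix. *)
Lemma sum_prod_upd (A : comNzRingType) (P C : finType) (w : {ffun P -> C}) k
    (h : C -> A) (X : {ffun P -> C} -> A) :
  \sum_(v : {ffun P -> C}) h (v k) * (\prod_(l | l != k) (w l == v l)%:R) * X v =
  \sum_c h c * X (upd w k c).
Proof.
rewrite (partition_big (fun v : {ffun P -> C} => v k) xpredT) //=.
apply: eq_bigr => c _; rewrite (bigD1 (upd w k c)) ?upd_same //=.
rewrite [X in _ + X]big1 ?addr0.
  by rewrite big1 ?mulr1 // => l lk; rewrite upd_neq // eqxx.
move=> v /andP[/eqP vk vw].
have [l] := ffun_neq vw; rewrite updE; have [->|lk wl] := eqVneq l k.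
  by rewrite vk eqxx.
by rewrite (bigD1 l) //= (eq_sym (w l)) (negbTE wl) mul0r mulr0 mul0r.
Qed.

(** * Rational parametrisation of the rotations of a coordinate plane *)

Section PlaneRotation.
Context (F : realFieldType) (n : nat) (a b : 'I_n).

Definition planeproj : 'M[F]_n := delta_mx a a + delta_mx b b.
Definition planeskew : 'M[F]_n := delta_mx a b - delta_mx b a.

(* The rotation of the (a, b)-plane by the angle [2 * atan t]. *)
Definition planerot (t : F) : 'M[F]_n :=
  1%:M - (2 * t ^+ 2 / (1 + t ^+ 2)) *: planeproj + (2 * t / (1 + t ^+ 2)) *: planeskew.

Lemma planerot_orth t : a != b -> (planerot t)^T *m planerot t = 1%:M.
Proof.
move=> ab; have ba : b != a by rewrite eq_sym.
have DT : planeproj^T = planeproj by rewrite linearD /= !trmx_delta.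
have JT : planeskew^T = - planeskew by rewrite linearB /= !trmx_delta opprB.
have DD : planeproj *m planeproj = planeproj.
  rewrite mulmxDl !mulmxDr !mul_delta_mx_cond !eqxx (negbTE ab) (negbTE ba).
  by rewrite !mulr0n !mulr1n addr0 add0r.
have DJ : planeproj *m planeskew = planeskew.
  rewrite mulmxDl !mulmxBr !mul_delta_mx_cond !eqxx (negbTE ab) (negbTE ba).
  by rewrite !mulr0n !mulr1n subr0 sub0r.
have JD : planeskew *m planeproj = planeskew.
  rewrite mulmxBl !mulmxDr !mul_delta_mx_cond !eqxx (negbTE ab) (negbTE ba).
  by rewrite !mulr0n !mulr1n add0r addr0.
have JJ : planeskew *m planeskew = - planeproj.
  rewrite mulmxBl !mulmxBr !mul_delta_mx_cond !eqxx (negbTE ab) (negbTE ba).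
  by rewrite !mulr0n !mulr1n sub0r subr0 /planeproj opprD.
rewrite /planerot; set x := _ / _; set y := _ / _.
(* With [x = 1 - cos] and [y = sin] of the rotation angle, this is the identity
   [cos ^ 2 + sin ^ 2 = 1]. *)
have xy : x ^+ 2 + y ^+ 2 = 2 * x.
  rewrite /x /y; field.
  by rewrite gt_eqF // ltr_pwDl ?sqr_ge0.
have -> : (1%:M - x *: planeproj + y *: planeskew)^T =
    1%:M - x *: planeproj - y *: planeskew.
  by rewrite linearD linearB /= !linearZ /= trmx1 DT JT scalerN.
rewrite !(mulmxDl, mulmxDr, mulmxBl, mulmxBr, mulNmx, mulmxN) !mul1mx !mulmx1.
rewrite -!(scalemxAl, scalemxAr) !scalerA DD DJ JD JJ.
apply/matrixP => i j; rewrite !mxE.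
set d := ((_ && _)%:R + _); set s := ((_ && _)%:R - _).
transitivity ((i == j)%:R + (x ^+ 2 + y ^+ 2 - 2 * x) * d); last first.
  by rewrite xy subrr mul0r addr0.
by ring.
Qed.

Lemma planerotE t i j : planerot t i j = (i == j)%:R
  - 2 * t ^+ 2 / (1 + t ^+ 2) * planeproj i j + 2 * t / (1 + t ^+ 2) * planeskew i j.
Proof. by rewrite !mxE. Qed.

End PlaneRotation.

(** * Consequences of orthogonal invariance, and the invariance of pairings *)

Section OrthogonalInvariants.
Context (F : realFieldType) (P : finType) (n : nat).
Local Notation tensor := ({ffun P -> 'I_n} -> F).
Implicit Types (X : tensor) (v w : {ffun P -> 'I_n}).

Definition orth_inv X : Prop := forall M : 'M[F]_n, M^T *m M = 1%:M ->
  forall w, \sum_(v : {ffun P -> 'I_n}) (\prod_k M (w k) (v k)) * X v = X w.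

Lemma orth_inv_even X : orth_inv X -> even_supp [set: P] X.
Proof.
move=> iX a w e.
(* The reflection in the coordinate [a] multiplies the entry of [X] at [w] by [-1] to the
   multiplicity of [a] in [w]. *)
pose d : 'rV[F]_n := \row_c (if c == a then -1 else 1).
have dd : (diag_mx d)^T *m diag_mx d = 1%:M.
  rewrite tr_diag_mx mul_mx_diag; apply/matrixP => i j; rewrite !mxE.
  have [->|] := eqVneq i j; last by rewrite mulr0n mul0r.
  by case: eqP; rewrite mulr1n ?mulrNN mulr1.
have := iX _ dd w; rewrite (bigD1 w) //= [X in _ + X]big1 ?addr0; last first.
  move=> v /ffun_neq[k vk].
  by rewrite (bigD1 k) //= !mxE (eq_sym (w k) (v k)) (negbTE vk) mulr0n !mul0r.
have -> : \prod_k diag_mx d (w k) (w k) = -1.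
  under eq_bigr => k _ do rewrite !mxE eqxx mulr1n.
  rewrite -big_mkcond prodr_const.
  have -> : #|[pred k | w k == a]| = mult [set: P] w a.
    by apply: eq_card => k; rewrite !inE.
  by rewrite -signr_odd e expr1.
by move=> h; lra.
Qed.

Lemma orth_inv_so_inv X : orth_inv X -> so_inv [set: P] X.
Proof.
move=> iX a b w; have [->//|ab] := eqVneq a b.
pose J : 'M[F]_n := planeskew F a b.
(* The entries of [planerot] multiplied by [1 + t ^ 2]. *)
pose Q (c d : 'I_n) : {poly F} :=
  (c == d)%:R * (1 + 'X^2) - (2 * planeproj F a b c d) *: 'X^2 + (2 * J c d) *: 'X.
have Q0 c d : (Q c d).[0] = (c == d)%:R.
  by rewrite /Q !hornerE /= expr0n /= !mulr0; case: (c == d); rewrite ?hornerE /=; ring.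
have Q1 c d : ((Q c d)^`()).[0] = 2 * J c d.
  by rewrite /Q !derivE; case: (c == d); rewrite !hornerE /=; ring.
have h0 : \sum_(v : {ffun P -> 'I_n}) (\prod_k Q (w k) (v k)) * (X v)%:P
    - (1 + 'X^2) ^+ #|P| * (X w)%:P = 0.
  apply: poly_nat_eq0 => t; rewrite !hornerE horner_sum.
  set u : F := t%:R.
  have u0 : 1 + u ^+ 2 != 0 by rewrite gt_eqF // ltr_pwDl ?sqr_ge0.
  rewrite -(iX _ (planerot_orth u ab) w) mulr_sumr -sumrB; apply: big1 => v _.
  rewrite hornerM hornerC horner_prod mulrA -prodr_const -big_split /= -mulrBl.
  apply/eqP; rewrite mulf_eq0 subr_eq0; apply/orP; left; apply/eqP.
  apply: eq_bigr => k _.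
  rewrite planerotE /Q; case: eqP => _; rewrite !hornerE /=; field; exact: u0.
have := congr1 (fun p : {poly F} => p^`().[0]) h0.
(* A power of [1 + 'X^2] has no linear term. *)
have q0 : (((1 + 'X^2) ^+ #|P| * (X w)%:P : {poly F})^`()).[0] = 0.
  by rewrite derivM derivC mulr0 addr0 deriv_exp !derivE !hornerM hornerMn
    hornerM !hornerE /= ?(mul0rn, mul0r, add0r).
rewrite /= derivB hornerD hornerN q0 subr0 raddf_sum horner_sum deriv0 horner0 /=.
under eq_bigr => v _.
  rewrite derivM derivC mulr0 addr0 hornerM hornerC deriv_prod horner_sum mulr_suml.
  under eq_bigr => k _.
    rewrite hornerM Q1 horner_prod; under eq_bigr do rewrite Q0; over.
  over.
rewrite exchange_big /=; under eq_bigr => k _.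
  rewrite (sum_prod_upd w k (fun c => 2 * J (w k) c) X); over.
move=> h; apply/eqP; rewrite -subr_eq0; apply/eqP.
have {h} : \sum_k ((if w k == a then X (upd w k b) else 0)
    - (if w k == b then X (upd w k a) else 0)) *+ 2 = 0.
  rewrite -[RHS]h; apply: eq_bigr => k _; rewrite /J /planeskew.
  rewrite (bigD1 a) //= (bigD1 b) ?(eq_sym b a) //= big1;
    last first => [c /andP[ca cb]|].
    by rewrite !mxE (negbTE ca) (negbTE cb) !andbF subrr mulr0 mul0r.
  rewrite !mxE !eqxx (eq_sym b a) (negbTE ab) !andbT !andbF.
  by have [->|_] := eqVneq (w k) a; rewrite ?(negbTE ab);
    last case: (w k == b); rewrite /=; ring.
rewrite sumrMnl sumrB => /eqP; rewrite mulrn_eq0 /= => /eqP.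
by rewrite -!big_mkcond /shift => h; rewrite -[RHS]h; congr (_ - _);
  apply: eq_bigl => k; rewrite inE.
Qed.

(** Let [M] act on the legs in [U] only and remove one block of the pairing at a time: summing over
    the common value of its two legs gives an entry of [M *m M^T], that is, the Kronecker delta of
    the block. *)
Lemma pairing_orth_inv p : pairing [set: P] p ->
  orth_inv (fun w => (matches p w)%:R).
Proof.
move=> hp M hM w.
have MMT : M *m M^T = 1%:M by exact: mulmx1C.
have MM (c d : 'I_n) : \sum_e M c e * M d e = (c == d)%:R.
  transitivity ((M *m M^T) c d); last by rewrite MMT mxE.
  by rewrite mxE; apply: eq_bigr => e _; rewrite mxE.
pose N (U : {set P}) k c d := if k \in U then M c d else (c == d)%:R.
suff H : forall U p, pairing U p ->
    \sum_(v : {ffun P -> 'I_n}) (\prod_k N U k (w k) (v k)) * (matches p v)%:R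
      = (matches p w)%:R.
  rewrite -[RHS](H _ _ hp); apply: eq_bigr => v _; congr (_ * _).
  by apply: eq_bigr => k _; rewrite /N inE.
move=> U; have [m] := ubnP #|U|; elim: m => // m IH in U * => leU {}p {}hp.
have [U0|/set0Pn[i iU]] := eqVneq U set0.
  rewrite (bigD1 w) //= [X in _ + X]big1 ?addr0 => [|v vw].
    by rewrite big1 ?mul1r // => k _; rewrite /N U0 inE eqxx.
  have [k vk] := ffun_neq vw.
  by rewrite (bigD1 k) //= /N U0 inE (eq_sym (w k) (v k)) (negbTE vk) !mul0r.
have [j [p' [ij jU hp' ->]]] := pairing_pick hp iU.
have ji : j != i by rewrite eq_sym.
set V := U :\ i :\ j in hp'.
have ltV : (#|V| < m)%N.
  move: leU; rewrite ltnS; apply: leq_trans.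
  apply: leq_ltn_trans (proper_card (properD1 iU)).
  by apply: subset_leq_card; exact: subsetDl.
rewrite matches_add -mulnb natrM -(IH _ ltV _ hp') mulr_sumr.
(* [sum_upd2] frees the legs [i] and [j] at the cost of this factor, which can be cancelled since
   [w i] witnesses that ['I_n] is inhabited. *)
have n0 : (#|'I_n| * #|'I_n|)%N != 0%N.
  by rewrite muln_eq0 orbb; apply/eqP => /card0_eq/(_ (w i)).
have inj : injective (fun x : F => x *+ (#|'I_n| * #|'I_n|)).
  by apply: pmulrnI; rewrite lt0n.
apply: inj; rewrite -!(sum_upd2 i j) /=; apply: eq_bigr => v _.
have E W c d : \prod_k N W k (w k) (upd (upd v i c) j d k) =
    N W i (w i) c *
    (N W j (w j) d * \prod_(k | (k != i) && (k != j)) N W k (w k) (v k)).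
  rewrite (bigD1 i) //= (bigD1 j) //= upd_same upd_neq // upd_same.
  by do 2!congr (_ * _); apply: eq_bigr => k /andP[ki kj]; rewrite !upd_neq.
set r := \prod_(k | (k != i) && (k != j)) N U k (w k) (v k).
have rV : r = \prod_(k | (k != i) && (k != j)) N V k (w k) (v k).
  by apply: eq_bigr => k /andP[ki kj]; rewrite /N !inE ki kj.
have mE c d : matches p' (upd (upd v i c) j d) = matches p' v.
  rewrite (matches_local (w := v) hp') // => k.
  by rewrite !inE => /and3P[kj ki _]; rewrite !upd_neq.
transitivity ((\sum_c M (w i) c * M (w j) c) * (r * (matches p' v)%:R)).
  rewrite mulr_suml; apply: eq_bigr => c _; rewrite (bigD1 c) //=.
  rewrite [X in _ + X]big1 ?addr0 => [|d dc].
    rewrite E -/r matches_add mE upd_same upd_neq // upd_same eqxx /=.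
    by rewrite /N iU jU; ring.
  by rewrite matches_add upd_same upd_neq // upd_same (eq_sym c) (negbTE dc) mulr0.
rewrite MM [RHS](bigD1 (w i)) //= [X in _ = _ + X]big1 ?addr0 => [|c ci]; last first.
  apply: big1 => d _; rewrite E -rV /N !inE !eqxx /= andbF.
  by rewrite (eq_sym (w i)) (negbTE ci) /=; ring.
rewrite [RHS](bigD1 (w j)) //= [X in _ = _ + X]big1 ?addr0 => [|d dj].
  by rewrite E -rV mE /N !inE !eqxx /= andbF /=; ring.
by rewrite E -rV /N !inE !eqxx /= (eq_sym (w j)) (negbTE dj) /=; ring.
Qed.

End OrthogonalInvariants.

(** The orthogonal projection of [X] to the span of the family, without assuming linear
    independence. Here [v] and [u] are the residuals of [X] and [f i] against the remaining
    functions, and the new residual is [v - t * u]. *)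
Lemma gram_schmidt (F : realFieldType) (I : eqType) (W : finType)
    (f : I -> W -> F) (r : seq I) (X : W -> F) : uniq r ->
  exists c : I -> F, {in r, forall i,
    \sum_w (X w - \sum_(j <- r) c j * f j w) * f i w = 0}.
Proof.
elim: r X => [X _|i r IH X /= /andP[ir ur]]; first by exists (fun=> 0).
have [c hc] := IH X ur; have [d hd] := IH (f i) ur.
pose v w := X w - \sum_(j <- r) c j * f j w.
pose u w := f i w - \sum_(j <- r) d j * f j w.
pose t := (\sum_w v w * u w) / (\sum_w u w * u w).
exists (fun j => if j == i then t else c j - t * d j) => k.
have E w : X w - \sum_(j <- i :: r) (if j == i then t else c j - t * d j) * f j w
    = v w - t * u w.
  rewrite big_cons eqxx /v /u mulrBr mulr_sumr.
  rewrite (eq_big_seq (fun j => c j * f j w - t * (d j * f j w))) => [|j jr].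
    by rewrite sumrB; ring.
  by have [ji|_] := eqVneq j i; [move: ir; rewrite -ji jr|ring].
under eq_bigr do rewrite E.
have Or j : j \in r -> \sum_w (v w - t * u w) * f j w = 0.
  move=> jr; under eq_bigr do rewrite mulrBl -mulrA.
  by rewrite sumrB -mulr_sumr hc // hd // mulr0 subr0.
rewrite inE => /orP[/eqP ->{k}|/Or//].
(* The new residual is orthogonal to the other functions, so [f i] may be replaced by [u]. *)
transitivity (\sum_w (v w - t * u w) * u w).
  rewrite /u; under [RHS]eq_bigr do rewrite mulrBr mulr_sumr.
  rewrite sumrB exchange_big /= [X in _ - X]big1_seq ?subr0 // => j /andP[_ jr].
  under eq_bigr do rewrite mulrCA.
  by rewrite -mulr_sumr (Or _ jr) mulr0.
under eq_bigr do rewrite mulrBl -mulrA.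
(* A vanishing denominator in [t] means [u = 0], and then the orthogonality is trivial. *)
rewrite sumrB -mulr_sumr; have [q0|q0] := eqVneq (\sum_w u w * u w) 0.
  have u0 w : u w = 0.
    apply/eqP; rewrite -sqrf_eq0 expr2; apply/eqP.
    by apply: (psumr_eq0P _ q0) => // ? _; rewrite -expr2 sqr_ge0.
  by rewrite q0 mulr0 subr0; apply: big1 => w _; rewrite u0 mulr0.
by rewrite /t divfK ?subrr.
Qed.

Lemma orth_inv_span (F : realFieldType) (P : finType) (n : nat)
    (X : {ffun P -> 'I_n} -> F) : orth_inv X ->
  exists c : {set {set P}} -> F, forall w,
    X w = \sum_(p | pairing [set: P] p) c p * (matches p w)%:R.
Proof.
move=> iX.
have [c hc] := gram_schmidt (fun p w => (matches p w)%:R : F) X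
  (enum_uniq (pairing [set: P])).
exists c => w; apply/eqP; rewrite -subr_eq0; apply/eqP; move: w.
pose Y w := X w - \sum_(p | pairing [set: P] p) c p * (matches p w)%:R.
have iY : orth_inv Y.
  move=> M hM w; under eq_bigr do rewrite mulrBr.
  rewrite sumrB iX //; congr (_ - _).
  under eq_bigr do rewrite mulr_sumr.
  rewrite exchange_big; apply: eq_bigr => p hp /=.
  rewrite -(pairing_orth_inv hp hM w) mulr_sumr.
  by apply: eq_bigr => v _; rewrite mulrCA.
apply: (@orth_pairings_eq0 F P 'I_n [set: P]).
- by move=> v w vw; congr Y; apply/ffunP => k; exact: vw.
- exact: orth_inv_so_inv.
- exact: orth_inv_even.
- move=> p hp; have := hc p; rewrite mem_enum => /(_ hp) h.
  rewrite -[RHS]h big_mkcond; apply: eq_bigr => w _ /=.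
  by rewrite /Y big_enum; case: matches; rewrite ?mulr1 ?mulr0.
Qed.

(** * The Hom spaces of [O_n^z] *)

From mathcomp Require Import complex boolp classical_sets topology.

Section Words.
Context (I : finType).

Lemma sum_word0 (V : nmodType) (G : mindex I [::] -> V) j : \sum_i G i = G j.
Proof.
by rewrite (bigD1 j) //= big1 ?addr0 // => i /eqP[]; apply/ffunP => -[].
Qed.

Definition word2 (a b : I) : {ffun 'I_2 -> I} :=
  [ffun k => if k == ord0 then a else b].

Lemma sum_word2 (V : nmodType) (G : {ffun 'I_2 -> I} -> V) :
  \sum_i G i = \sum_a \sum_b G (word2 a b).
Proof.
rewrite pair_big /= (reindex (fun p => word2 p.1 p.2)) //.
exists (fun i : {ffun 'I_2 -> I} => (i ord0, i ord_max)) => [[a b]|i] _ /=.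
  by rewrite !ffunE.
apply/ffunP => k; rewrite ffunE; case: eqP => [->//|/eqP k0].
by congr (i _); apply: val_inj; case: k k0 => [[|[|]]].
Qed.

End Words.

(** * Solutions of the conjugate equations read off from the Hom spaces *)

Section ConjugateOfHom.
Context (R : realType) (I : finType) (G : cmqg R I) (ubar : I -> I -> G).

Lemma Hom_word2 (c1 c2 : colour) :
  Hom_rep (rep_word ubar [::]) (rep_word ubar [:: c1; c2])
    (fun i _ => (i ord0 == i ord_max)%:R) ->
  Hom_rep (triv_rep G)
    (mtop (by_colour (qg_fund G) ubar c1) (by_colour (qg_fund G) ubar c2))
    (fun ab _ => (ab.1 == ab.2)%:R).
Proof.
move=> h [a b] []; pose j : mindex I [::] := [ffun _ => a].
have := h (word2 a b) j; rewrite /mmul (sum_word0 _ j) sum_word2.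
rewrite {1}/rep_word /tpow big_ord0 /mscal !ffunE /= => E.
rewrite /mmul (bigD1 tt) //= big1 ?addr0 => [|[]//].
rewrite {}E pair_big; apply: eq_bigr => -[c d] _ /=.
by rewrite /rep_word /tpow !big_ord_recl big_ord0 mulr1 !ffunE.
Qed.

(** The tensor [\sum_a e_a (x) e_a] serves as both [R] and [S]. *)
Lemma conjugate_rep_Hom :
  (forall c1 c2, Hom_rep (rep_word ubar [::]) (rep_word ubar [:: c1; c2])
    (fun i _ => (i ord0 == i ord_max)%:R)) ->
  conjugate_rep ubar.
Proof.
move=> h; exists (fun ab _ => (ab.1 == ab.2)%:R), (fun ab _ => (ab.1 == ab.2)%:R).
have E (a c : I) : \sum_b ((a == b)%:R : R[i])^* * (b == c)%:R = (a == c)%:R.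
  rewrite (bigD1 a) //= big1 => [|b ba]; first by rewrite eqxx conjC1 mul1r addr0.
  by rewrite eq_sym (negbTE ba) conjC0 mul0r.
split=> //; [exact: (Hom_word2 (h White Black))|exact: (Hom_word2 (h Black White))].
Qed.

End ConjugateOfHom.

(** * Morphisms between tensor powers as tensors on the points of a partition *)

Section TensorCoordinates.
Context (R : realType) (n : nat) (z : word).
Local Notation idx := (mindex 'I_n z).
Implicit Types (M N : 'M[R]_n) (x y : word).

Definition wpow M x (i j : mindex idx x) : R := tpow (fun _ => mxpow M) x i j.

Lemma wpow_mul M N x i j : wpow (M *m N) i j = \sum_k wpow M (x := x) i k * wpow N k j.
Proof.
rewrite /wpow /tpow; under eq_bigr do rewrite mxpow_mul.
by rewrite bigA_distr_bigA /=; apply: eq_bigr => k _; rewrite big_split.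
Qed.

Lemma wpow1 x (i j : mindex idx x) : wpow 1%:M i j = (i == j)%:R.
Proof.
rewrite /wpow /tpow; have [->|/ffun_neq[k kij]] := eqVneq i j.
  by apply: big1 => k _; rewrite mxpow1 eqxx.
by rewrite (bigD1 k) //= mxpow1 (negbTE kij) mul0r.
Qed.

Lemma wpowT M x (i j : mindex idx x) : wpow M^T i j = wpow M j i.
Proof. by apply: eq_bigr => k _; rewrite mxpowT. Qed.

Lemma wpow_orthr M x (i j : mindex idx x) : orth M ->
  \sum_k wpow M i k * wpow M j k = (i == j)%:R.
Proof.
move=> /mulmx1C hM; rewrite -wpow1 -hM wpow_mul.
by apply: eq_bigr => k _; rewrite wpowT.
Qed.

Lemma wpow_orthl M x (i j : mindex idx x) : orth M ->
  \sum_k wpow M k i * wpow M k j = (i == j)%:R.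
Proof.
move=> hM; rewrite -wpow1 -hM wpow_mul.
by apply: eq_bigr => k _; rewrite wpowT.
Qed.

Section Labels.
Context (x y : word).
Local Notation P := (spoint (size z) x y).

(** Joins the output index [i] and the input index [j] into one multi-index on all points, so that a
    matrix coefficient becomes a tensor coordinate. *)
Definition label (i : mindex idx y) (j : mindex idx x) : {ffun P -> 'I_n} :=
  [ffun a => plabel j i a].

Definition upper (w : {ffun P -> 'I_n}) : mindex idx x :=
  [ffun k => [ffun l => w (lshift (size y) k, l)]].

Definition lower (w : {ffun P -> 'I_n}) : mindex idx y :=
  [ffun k => [ffun l => w (rshift (size x) k, l)]].

Lemma upperE w k l : upper w k l = w (lshift (size y) k, l).
Proof. by rewrite !ffunE. Qed.

Lemma lowerE w k l : lower w k l = w (rshift (size x) k, l).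
Proof. by rewrite !ffunE. Qed.

Lemma label_lshift i j k l : label i j (lshift (size y) k, l) = j k l.
Proof. by rewrite ffunE /plabel /= (unsplitK (inl k)). Qed.

Lemma label_rshift i j k l : label i j (rshift (size x) k, l) = i k l.
Proof. by rewrite ffunE /plabel /= (unsplitK (inr k)). Qed.

Lemma labelK w : label (lower w) (upper w) = w.
Proof.
apply/ffunP => -[k l]; case: (split_ordP k) => q ->.
  by rewrite label_lshift upperE.
by rewrite label_rshift lowerE.
Qed.

Lemma lower_label i j : lower (label i j) = i.
Proof. by apply/ffunP => k; apply/ffunP => l; rewrite lowerE label_rshift. Qed.

Lemma upper_label i j : upper (label i j) = j.
Proof. by apply/ffunP => k; apply/ffunP => l; rewrite upperE label_lshift. Qed.

Lemma sum_label (V : nmodType) (G : {ffun P -> 'I_n} -> V) :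
  \sum_w G w = \sum_i \sum_j G (label i j).
Proof.
rewrite pair_big /= (reindex (fun p => label p.1 p.2)) //.
by exists (fun w => (lower w, upper w)) => [[i j]|w] _ /=;
  rewrite ?labelK ?lower_label ?upper_label.
Qed.

Lemma prod_label M i j i' j' :
  \prod_a M (label i j a) (label i' j' a) = wpow M i i' * wpow M j j'.
Proof.
transitivity (\prod_k \prod_l M (label i j (k, l)) (label i' j' (k, l))).
  by rewrite pair_bigA /=; apply: eq_bigr => -[].
rewrite big_split_ord /= mulrC.
congr (_ * _); apply: eq_bigr => k _; apply: eq_bigr => l _.
  by rewrite !label_rshift.
by rewrite !label_lshift.
Qed.

Lemma Tmap_matches p i j : Tmap R p i j = (matches p (label i j))%:R.
Proof.
congr (nat_of_bool _)%:R; apply: eq_forallb_in => B _.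
by apply: eq_forallb_in => a _; apply: eq_forallb_in => b _; rewrite !ffunE.
Qed.

End Labels.

Local Notation wbar := (@orth_fund R n z).

Definition orth_point M (hM : orth M) : orth_space R n := SigSub (mem_set hM).

Lemma subC_val_mul (a b : On_z R n z) g :
  subC_val (a * b) g = subC_val a g * subC_val b g.
Proof. by []. Qed.

Lemma subC_val_mscal (K L : finType) (S : K -> L -> R[i]) k l g :
  subC_val (mscal (On_z R n z) S k l) g = S k l.
Proof. exact: mulr1. Qed.

Lemma subC_val_prod (K : Type) (r : seq K) (H : K -> On_z R n z) g :
  subC_val (\prod_(k <- r) H k) g = \prod_(k <- r) subC_val (H k) g.
Proof. by elim: r => [|k r IH]; rewrite ?big_nil ?big_cons ?mkCK //= IH. Qed.

(** The entries of [u^z] are real functions, so [u^z] also represents the black letter and the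
    colours in [x] do not matter. *)
Lemma rep_wordE x (i j : mindex idx x) g :
  subC_val (rep_word (G := On_z R n z) wbar x i j) g = (wpow (orth_val g) i j)%:C%C.
Proof.
rewrite subC_val_prod rmorph_prod; apply: eq_bigr => k _.
by case: (nth White x k) => /=; rewrite orth_fundE.
Qed.

(** Equations in the function algebra hold pointwise on the group, and [wpow M] is orthogonal, so it
    can be moved from one side of the intertwining relation to the other. *)
Lemma Hom_On_z x y (S : mindex idx y -> mindex idx x -> R[i]) :
  Hom_rep (rep_word (G := On_z R n z) wbar x) (rep_word (G := On_z R n z) wbar y) S <->
  forall M, orth M -> forall i j,
    \sum_i' \sum_j' (wpow M i i' * wpow M j j')%:C%C * S i' j' = S i j.
Proof.
pose U M q (i j : mindex idx q) : R[i] := (wpow M i j)%:C%C.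
have Ur M q (i j : mindex idx q) : orth M -> \sum_k U M q i k * U M q j k = (i == j)%:R.
  move=> hM; rewrite -[RHS](rmorph_nat (real_complex R)) -(wpow_orthr i j hM).
  rewrite rmorph_sum /=.
  by apply: eq_bigr => k _; rewrite /U rmorphM.
have Ul M q (i j : mindex idx q) : orth M -> \sum_k U M q k i * U M q k j = (i == j)%:R.
  move=> hM; rewrite -[RHS](rmorph_nat (real_complex R)) -(wpow_orthl i j hM).
  rewrite rmorph_sum /=.
  by apply: eq_bigr => k _; rewrite /U rmorphM.
have pick (T : finType) (G : T -> R[i]) t : \sum_s G s * (t == s)%:R = G t.
  rewrite (bigD1 t) //= eqxx mulr1 big1 ?addr0 // => s st.
  by rewrite eq_sym (negbTE st) mulr0.
transitivity (forall M, orth M -> forall i j,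
    \sum_k S i k * U M x k j = \sum_k U M y i k * S k j).
  have e1 i j g : subC_val (mmul (mscal (On_z R n z) S)
      (rep_word (G := On_z R n z) wbar x) i j) g =
      \sum_k S i k * U (orth_val g) x k j.
    rewrite /mmul evA_sum; apply: eq_bigr => k _.
    by rewrite subC_val_mul rep_wordE subC_val_mscal.
  have e2 i j g : subC_val (mmul (rep_word (G := On_z R n z) wbar y)
      (mscal (On_z R n z) S) i j) g =
      \sum_k U (orth_val g) y i k * S k j.
    rewrite /mmul evA_sum; apply: eq_bigr => k _.
    by rewrite subC_val_mul rep_wordE subC_val_mscal.
  split=> [h M hM i j|h i j].
    rewrite -[M]/(orth_val (orth_point hM)) -e1 -e2.
    by have -> := h i j.
  apply: subC_inj; apply: contC_eq => g.
  by rewrite e1 e2; apply: h; exact: orth_valP.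
split=> h M hM i j.
  transitivity (\sum_j' U M x j j' * \sum_i' U M y i i' * S i' j').
    rewrite exchange_big; apply: eq_bigr => j' _; rewrite mulr_sumr.
    by apply: eq_bigr => i' _; rewrite rmorphM /U /=; ring.
  transitivity (\sum_k S i k * \sum_j' U M x j j' * U M x k j').
    under eq_bigr do rewrite -h // mulr_sumr; rewrite exchange_big.
    by apply: eq_bigr => k _; rewrite mulr_sumr; apply: eq_bigr => j' _; rewrite mulrCA.
  by under eq_bigr do rewrite Ur //; exact: pick.
transitivity (\sum_k \sum_i' \sum_j' U M y i i' * S i' j' * (U M x k j * U M x k j')).
  apply: eq_bigr => k _; rewrite -(h M hM i k) mulr_suml; apply: eq_bigr => i' _.
  rewrite mulr_suml; apply: eq_bigr => j' _.
  by rewrite rmorphM /U /=; ring.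
rewrite exchange_big; apply: eq_bigr => i' _; rewrite exchange_big /=.
under eq_bigr do rewrite -mulr_sumr Ul // -mulrA.
by rewrite -mulr_sumr pick.
Qed.

Lemma Hom_On_z_Tspan x y :
  Hom_rep (rep_word (G := On_z R n z) wbar x) (rep_word (G := On_z R n z) wbar y) =
  @Tspan R (size z) n (pair_partitions (size z)) x y.
Proof.
rewrite eqEsubset; split=> S; last first.
  move=> [c ->]; apply/Hom_On_z => M hM i j.
  under eq_bigr do under eq_bigr do rewrite mulr_sumr.
  under eq_bigr do rewrite exchange_big /=.
  rewrite exchange_big /=; apply: eq_bigr => p; rewrite !inE => hp.
  have := pairing_orth_inv hp hM (label i j); rewrite sum_label => E.
  rewrite Tmap_matches -(rmorph_nat (real_complex R)) -E rmorph_sum mulr_sumr.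
  apply: eq_bigr => i' _; rewrite rmorph_sum mulr_sumr; apply: eq_bigr => j' _.
  by rewrite Tmap_matches prod_label [in RHS]rmorphM rmorph_nat mulrCA.
move=> /Hom_On_z hS.
(* The group acts by real matrices, so the real and imaginary parts of [S] are invariant separately;
   [h] stands for either. *)
have key (h : {additive R[i] -> R}) : (forall (a : R) s, h (a%:C%C * s) = a * h s) ->
    exists c : {set {set spoint (size z) x y}} -> R, forall i j,
    h (S i j) = \sum_(p | pairing [set: _] p) c p * (matches p (label i j))%:R.
  move=> hZ.
  have [c hc] : exists c : {set {set spoint (size z) x y}} -> R, forall w,
      h (S (lower w) (upper w)) =
      \sum_(p | pairing [set: _] p) c p * (matches p w)%:R.
    apply: orth_inv_span => M hM w; rewrite sum_label.
    rewrite -(hS M hM) raddf_sum; apply: eq_bigr => i _.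
    rewrite raddf_sum; apply: eq_bigr => j _.
    by rewrite hZ lower_label upper_label -{1}(labelK w) prod_label.
  by exists c => i j; rewrite -hc lower_label upper_label.
have [|c hc] := key (@complex.Re R); first by move=> a [u v] /=; ring.
have [|d hd] := key (@complex.Im R); first by move=> a [u v] /=; ring.
exists (fun p => (c p +i* d p)%C); apply/funext => i; apply/funext => j.
rewrite [LHS]complexE hc hd !rmorph_sum mulr_sumr -big_split /=.
apply: eq_big => p; first by rewrite !inE.
move=> _; rewrite Tmap_matches [(c p +i* d p)%C]complexE /=.
by rewrite !rmorphM !rmorph_nat mulrDl mulrA.
Qed.

End TensorCoordinates.

(** * The equivalence, realised by the identity matrix *)

Lemma equivalent_On_z (R : realType) (n : nat) (z : word)
    (G : cmqg R {ffun 'I_(size z) -> 'I_n}) :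
  is_G (pair_partitions (size z)) G -> equivalent G (On_z R n z).
Proof.
case=> [[ubar [urep uHom]] _].
pose wbar : mindex 'I_n z -> mindex 'I_n z -> On_z R n z := @orth_fund R n z.
(* The tensor [\sum_a e_a (x) e_a] is fixed because [M *m M^T = 1%:M], passed to tensor powers. *)
have cHom c1 c2 : Hom_rep (rep_word wbar [::]) (rep_word wbar [:: c1; c2])
    (fun i _ => (i ord0 == i ord_max)%:R).
  apply/Hom_On_z => M hM i j; rewrite sum_word2.
  transitivity (\sum_a (wpow M i (word2 a a) )%:C%C : R[i]).
    apply: eq_bigr => a _; rewrite (bigD1 a) //= [X in _ + X]big1 ?addr0.
      rewrite (sum_word0 _ j) !ffunE /= eqxx mulr1.
      by rewrite [wpow M j j]big_ord0 mulr1.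
    move=> b ba; apply: big1 => j' _.
    by rewrite !ffunE /= eq_sym (negbTE ba) mulr0.
  rewrite -rmorph_sum -[RHS](rmorph_nat (real_complex R)); congr (_%:C%C).
  rewrite -(mxpow1 R) -(mulmx1C hM) mxpow_mul; apply: eq_bigr => a _.
  rewrite /wpow /tpow !big_ord_recl big_ord0 mulr1 !ffunE mxpowT.
  by congr (_ * mxpow M (i _) a); exact: val_inj.
exists ubar, wbar; split=> //.
(* The Hom spaces of both quantum groups agree, so the same tensor makes [ubar] a conjugate. *)
- by apply: conjugate_rep_Hom => c1 c2; rewrite uHom -Hom_On_z_Tspan.
- split; last exact: orth_fund_unitary.
  split; last exact: orth_comul_fund.
  by exists (madj wbar); exact: orth_fund_unitary.
- exact: conjugate_rep_Hom.
pose Q (j i : mindex 'I_n z) : R[i] := (j == i)%:R.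
have QJ : cadj Q =2 Q.
  by move=> j i; rewrite /cadj /Q eq_sym; case: eqP => _; rewrite ?conjC1 ?conjC0.
have QQ : mmul Q Q =2 Q.
  move=> j i; rewrite /mmul (bigD1 j) //= big1 ?addr0 => [|k kj].
    by rewrite /Q eqxx mul1r.
  by rewrite /Q eq_sym (negbTE kj) mul0r.
exists Q; split.
  by split=> j i; rewrite -[RHS]QQ; apply: eq_bigr => k _; rewrite QJ.
move=> x y.
have tQ (f : colour -> mindex 'I_n z -> mindex 'I_n z -> R[i]) q :
    (forall c, f c =2 Q) -> forall i j, tpow f q i j = (i == j)%:R.
  move=> fQ i j; rewrite /tpow; have [->|/ffun_neq[k kij]] := eqVneq i j.
    by apply: big1 => k _; rewrite fQ /Q eqxx.
  by rewrite (bigD1 k) //= fQ /Q (negbTE kij) mul0r.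
have tl q : tpow (by_colour (cadj Q) (cconj (cadj Q))) q =2 fun i j => (i == j)%:R.
  by apply: tQ => -[] i j /=; rewrite ?/cconj QJ // /Q;
    case: eqP => _; rewrite ?conjC1 ?conjC0.
have tr q : tpow (by_colour Q (cconj Q)) q =2 fun i j => (i == j)%:R.
  by apply: tQ => -[] i j //=; rewrite /cconj /Q;
    case: eqP => _; rewrite ?conjC1 ?conjC0.
have idE (S : mindex (mindex 'I_n z) y -> mindex (mindex 'I_n z) x -> R[i]) :
    mmul (mmul (tpow (by_colour (cadj Q) (cconj (cadj Q))) y) S)
      (tpow (by_colour Q (cconj Q)) x) = S.
  apply/funext => i; apply/funext => j; rewrite /mmul (bigD1 j) //= tr eqxx mulr1.
  rewrite [X in _ + X]big1 ?addr0 => [|k kj]; last by rewrite tr (negbTE kj) mulr0.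
  rewrite (bigD1 i) //= tl eqxx mul1r big1 ?addr0 // => k ki.
  by rewrite tl eq_sym (negbTE ki) mul0r.
rewrite uHom -Hom_On_z_Tspan eqEsubset; split=> [S hS|_ [S hS <-]].
  by exists S => //; exact: idE.
by rewrite idE.
Qed.

Theorem proposition5p10 (R : realType) (m n : nat) (hm : (0 < m)%N)
    (G : cmqg R {ffun 'I_m -> 'I_n}) (hG : is_G (pair_partitions m) G) :
  equivalent G (On_z R n (nseq m White)).
Proof.
(* The types ['I_m] and ['I_(size (nseq m White))] are not convertible, so the word is generalised
   and [m] is replaced by its length. *)
move: (size_nseq m White) G hG; generalize (nseq m White) => z Ez.
by case: m / Ez hm => _ G hG; exact: equivalent_On_z.
Qed.
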